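(* Let $T$ be a commutative domain, let ${\bf q}=\{q_{ij}\in T^{\times}\mid 1\leq i<j\leq n\}$ be such that each $q_{ij}$ ($i<j$) is a root of unity and $q_{ij}\neq 1$, and let ${\mathcal A}=\{a_{ij}\in T\mid 1\leq i<j\leq n\}$. Let $T_{\bf q}[x_1,\dots,x_n]$ be the skew polynomial ring, $V_n({\bf q},{\mathcal A})$ the generalized quantum Weyl algebra associated to $({\bf q},{\mathcal A})$, and let $L_i$, $I_{p,m}$ and $\overline{Y}_{p,m}$ be the integers, index sets and matrices attached to ${\bf q}$ as defined in the context. (1) The following are equivalent: (i) the center of $T_{\bf q}[x_1,\dots,x_n]$ is a polynomial ring over $T$; (ii) the center of $T_{\bf q}[x_1,\dots,x_n]$ is $T[x_1^{L_1},\dots,x_n^{L_n}]$; (iii) $\det(\overline{Y}_{p,m})\neq 0$ in ${\mathbb F}_p$ for all primes $p$ and all integers $m>0$ such that $I_{p,m}\neq\emptyset$. (2) If the center of $T_{\bf q}[x_1,\dots,x_n]$ is the subalgebra $T[x_1^{L_1},\dots,x_n^{L_n}]$, then the center of $V_n({\bf q},{\mathcal A})$ is the subalgebra $T[x_1^{L_1},\dots,x_n^{L_n}]$, and $V_n({\bf q},{\mathcal A})$ is finitely generated and free as a module over $T[x_1^{L_1},\dots,x_n^{L_n}]$.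
   Context: The skew polynomial ring $T_{\bf q}[x_1,\dots,x_n]$ is the $T$-algebra (with $T$ central) generated by $x_1,\dots,x_n$ subject to $x_jx_i=q_{ij}x_ix_j$ for all $1\leq i<j\leq n$. The generalized quantum Weyl algebra is the algebra $V_n({\bf q},{\mathcal A})=T\langle x_1,\dots,x_n\rangle/(x_jx_i-q_{ij}x_ix_j-a_{ij}\mid i<j)$ ($T$ central), filtered by $\deg x_i=1$ and $\deg t=0$ for $t\in T$, and it is part of its definition that $({\bf q},{\mathcal A})$ is such that the associated graded ring $\mathrm{gr}\,V_n({\bf q},{\mathcal A})$ is naturally isomorphic to $T_{\bf q}[x_1,\dots,x_n]$. Conventions: $q_{ji}=q_{ij}^{-1}$ and $q_{ii}=1$. Let $d_{ij}$ be the order of $q_{ij}$. Identify the (finite cyclic) subgroup of $T^{\times}$ generated by the $q_{ij}$ with a group of complex roots of unity and write $q_{ij}=\exp(2\pi\sqrt{-1}\,k_{ij}/d_{ij})$ with integers $k_{ij}$ satisfying $|k_{ij}|<d_{ij}$, $\gcd(k_{ij},d_{ij})=1$, chosen so that $k_{ij}=-k_{ji}$; if $q_{ij}=1$ then $k_{ij}=0$, $d_{ij}=1$ (in particular $k_{ii}=0$, $d_{ii}=1$). Let $L_i=\mathrm{lcm}\{d_{ij}\mid j=1,\dots,n\}$ and let $\overline{Y}$ be the integer matrix $(k_{ij}L_i/d_{ij})_{n\times n}$. For a prime $p$ and an integer $m>0$, let $I_{p,m}$ be the set of indices $i$ with $L_i\in p^m{\mathbb Z}\setminus p^{m+1}{\mathbb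 Z}$, and let $\overline{Y}_{p,m}$ be the submatrix of $\overline{Y}$, with entries reduced modulo $p$, formed by the rows and columns with indices in $I_{p,m}$. Here $T[x_1^{L_1},\dots,x_n^{L_n}]$ denotes the $T$-subalgebra generated by the elements $x_i^{L_i}$. *)

(* Defs.v *)
From HB Require Import structures.
From mathcomp Require Import all_boot all_order all_algebra.
From mathcomp Require Import finmap.
From mathcomp Require Import monalg mpoly.
From mathcomp Require Import boolp reals trigo.
From mathcomp Require Import complex.

Set Implicit Arguments.
Unset Strict Implicit.
Unset Printing Implicit Defensive.

Import GRing.Theory.
Local Open Scope ring_scope.

(* MathComp's algType requires 1 != 0, which is not known a priori for an     *)
(* algebra given by generators and relations, or for its associated graded    *)
(* ring. They are therefore built as possibly zero rings (pzRingType), and a  *)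
(* T-algebra is such a ring together with the images of the constants of T.   *)

Record ideal (A : pzRingType) := Ideal {
  mem_ideal :> A -> Prop;
  ideal_0 : mem_ideal 0;
  ideal_D : forall x y, mem_ideal x -> mem_ideal y -> mem_ideal (x + y);
  ideal_Ml : forall a x, mem_ideal x -> mem_ideal (a * x);
  ideal_Mr : forall a x, mem_ideal x -> mem_ideal (x * a) }.

Section QuotientRing.
Variables (A : pzRingType) (I : ideal A).

Definition ideal_pred : {pred A} := fun x => `[< I x >].

Lemma ideal_predP x : reflect (I x) (x \in ideal_pred).
Proof. exact: asboolP. Qed.

Fact ideal_zmod_closed : zmod_closed ideal_pred.
Proof.
split=> [|x y /ideal_predP Ix /ideal_predP Iy].
  exact/ideal_predP/ideal_0.
by apply/ideal_predP/ideal_D; rewrite // -mulN1r; apply: ideal_Ml.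
Qed.

HB.instance Definition _ := GRing.isZmodClosed.Build A ideal_pred
  ideal_zmod_closed.

Definition quot_ring : Type := Quotient.quot ideal_pred.

HB.instance Definition _ := GRing.Zmodule.on quot_ring.

Definition to_quot (x : A) : quot_ring := \pi_(Quotient.quot ideal_pred)%qT x.

Definition quot_repr (y : quot_ring) : A :=
  repr (y : Quotient.quot ideal_pred).

Lemma quot_reprK y : to_quot (quot_repr y) = y.
Proof. exact: reprK. Qed.

Lemma to_quot_eq x y : to_quot x = to_quot y <-> I (x - y).
Proof.
split=> [/eqP|Ixy].
  by rewrite /to_quot -Quotient.idealrBE => /ideal_predP.
by apply/eqP; rewrite /to_quot -Quotient.idealrBE; apply/ideal_predP.
Qed.

Fact to_quot_zmod_morphism : zmod_morphism to_quot.
Proof. exact: raddfB. Qed.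

HB.instance Definition _ := GRing.isZmodMorphism.Build A quot_ring to_quot
  to_quot_zmod_morphism.

Definition quot_mul : quot_ring -> quot_ring -> quot_ring :=
  locked (fun x y => to_quot (quot_repr x * quot_repr y)).

Fact to_quotM x y : quot_mul (to_quot x) (to_quot y) = to_quot (x * y).
Proof.
set x' := quot_repr (to_quot x); set y' := quot_repr (to_quot y).
have -> : quot_mul (to_quot x) (to_quot y) = to_quot (x' * y').
  by rewrite /quot_mul -lock.
apply/to_quot_eq.
have Ix : I (x' - x) by apply/to_quot_eq; rewrite quot_reprK.
have Iy : I (y' - y) by apply/to_quot_eq; rewrite quot_reprK.
rewrite (_ : _ - _ = (x' - x) * y' + x * (y' - y)).
  by apply: ideal_D; [apply: ideal_Mr | apply: ideal_Ml].
by rewrite mulrBl mulrBr addrA subrK.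
Qed.

Lemma quot_ringP (y : quot_ring) : exists x, y = to_quot x.
Proof. by exists (quot_repr y); rewrite quot_reprK. Qed.

Fact quot_mulA : associative quot_mul.
Proof.
move=> x y z; case: (quot_ringP x) (quot_ringP y) (quot_ringP z).
by move=> {}x -> [{}y ->] [{}z ->]; rewrite !to_quotM mulrA.
Qed.

Fact quot_mul1l : left_id (to_quot 1) quot_mul.
Proof. by move=> x; case: (quot_ringP x) => {}x ->; rewrite to_quotM mul1r. Qed.

Fact quot_mul1r : right_id (to_quot 1) quot_mul.
Proof. by move=> x; case: (quot_ringP x) => {}x ->; rewrite to_quotM mulr1. Qed.

Fact quot_mulDl : left_distributive quot_mul +%R.
Proof.
move=> x y z; case: (quot_ringP x) (quot_ringP y) (quot_ringP z).
move=> {}x -> [{}y ->] [{}z ->].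
by rewrite -raddfD !to_quotM mulrDl raddfD.
Qed.

Fact quot_mulDr : right_distributive quot_mul +%R.
Proof.
move=> x y z; case: (quot_ringP x) (quot_ringP y) (quot_ringP z).
move=> {}x -> [{}y ->] [{}z ->].
by rewrite -raddfD !to_quotM mulrDr raddfD.
Qed.

HB.instance Definition _ := GRing.Zmodule_isPzRing.Build quot_ring
  quot_mulA quot_mul1l quot_mul1r quot_mulDl quot_mulDr.

Fact to_quot_monoid_morphism : monoid_morphism to_quot.
Proof. by split=> // x y; rewrite -to_quotM. Qed.

HB.instance Definition _ := GRing.isMonoidMorphism.Build A quot_ring to_quot
  to_quot_monoid_morphism.

End QuotientRing.

Section GeneratedIdeal.
Variables (A : pzRingType) (S : A -> Prop).

Inductive in_ideal_gen : A -> Prop :=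
| ideal_gen0 : in_ideal_gen 0
| ideal_genD a s b x :
    S s -> in_ideal_gen x -> in_ideal_gen (a * s * b + x).

Fact in_ideal_genD x y :
  in_ideal_gen x -> in_ideal_gen y -> in_ideal_gen (x + y).
Proof.
elim=> [|a s b {}x Ss _ IHx] Iy; first by rewrite add0r.
by rewrite -addrA; apply: ideal_genD => //; apply: IHx.
Qed.

Fact in_ideal_genMl a x : in_ideal_gen x -> in_ideal_gen (a * x).
Proof.
elim=> [|b s c {}x Ss _ IHx]; first by rewrite mulr0; apply: ideal_gen0.
by rewrite mulrDr !mulrA; apply: ideal_genD.
Qed.

Fact in_ideal_genMr a x : in_ideal_gen x -> in_ideal_gen (x * a).
Proof.
elim=> [|b s c {}x Ss _ IHx]; first by rewrite mul0r; apply: ideal_gen0.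
by rewrite mulrDl -mulrA; apply: ideal_genD.
Qed.

Definition ideal_gen : ideal A :=
  Ideal ideal_gen0 in_ideal_genD in_ideal_genMl in_ideal_genMr.

End GeneratedIdeal.

Inductive subring_gen (A : pzRingType) (S : A -> Prop) : A -> Prop :=
| subring_gen_mem x : S x -> subring_gen S x
| subring_gen1 : subring_gen S 1
| subring_genB x y :
    subring_gen S x -> subring_gen S y -> subring_gen S (x - y)
| subring_genM x y :
    subring_gen S x -> subring_gen S y -> subring_gen S (x * y).

Definition central (A : pzRingType) (z : A) : Prop :=
  forall y, GRing.comm z y.

Record filtration (A : pzRingType) := Filtration {
  fil :> nat -> A -> Prop;
  fil_0 : forall m, fil m 0;
  fil_B : forall m x y, fil m x -> fil m y -> fil m (x - y);
  fil_S : forall m x, fil m x -> fil m.+1 x;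
  fil_1 : fil 0 1;
  fil_M : forall l m x y, fil l x -> fil m y -> fil (l + m) (x * y) }.

(* Sequences in A with the Cauchy product, i.e. formal power series A[[t]].   *)
Definition seqring (A : pzRingType) : Type := nat -> A.

Section SeqRing.
Variable A : pzRingType.
Implicit Types f g h : seqring A.

HB.instance Definition _ := gen_eqMixin (seqring A).
HB.instance Definition _ := gen_choiceMixin (seqring A).

Definition seqr_single m (a : A) : seqring A :=
  fun k => if k == m then a else 0.
Definition seqr_add f g : seqring A := fun m => f m + g m.
Definition seqr_opp f : seqring A := fun m => - f m.
Definition seqr_mul f g : seqring A :=
  fun m => \sum_(i < m.+1) f i * g (m - i)%N.

Fact seqr_addA : associative seqr_add.
Proof. by move=> f g h; apply/funext => m; apply: addrA. Qed.
Fact seqr_addC : commutative seqr_add.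
Proof. by move=> f g; apply/funext => m; apply: addrC. Qed.
Fact seqr_add0 : left_id (fun=> 0) seqr_add.
Proof. by move=> f; apply/funext => m; apply: add0r. Qed.
Fact seqr_addN : left_inverse (fun=> 0) seqr_opp seqr_add.
Proof. by move=> f; apply/funext => m; apply: addNr. Qed.

HB.instance Definition _ := GRing.isZmodule.Build (seqring A)
  seqr_addA seqr_addC seqr_add0 seqr_addN.

Lemma seqr_mul_rev f g m :
  seqr_mul f g m = \sum_(i < m.+1) f (m - i)%N * g i.
Proof.
rewrite /seqr_mul (reindex_inj rev_ord_inj) /=.
by apply: eq_bigr => i _; rewrite (sub_ordK i).
Qed.

Fact seqr_mulA : associative seqr_mul.
Proof.
move=> p q r; apply/funext=> i.
rewrite [RHS]seqr_mul_rev -[LHS]/(\sum_(j < i.+1) p j * seqr_mul q r (i - j)%N).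
pose coef3 j k := p j * (q (i - j - k)%N * r k).
transitivity (\sum_(j < i.+1) \sum_(k < i.+1 | (k <= i - j)%N) coef3 j k).
  apply: eq_bigr => /= j _; rewrite seqr_mul_rev big_distrr /=.
  by rewrite (big_ord_narrow_leq (leq_subr _ _)).
rewrite (exchange_big_dep predT) //=; apply: eq_bigr => k _.
transitivity (\sum_(j < i.+1 | (j <= i - k)%N) coef3 j k).
  apply: eq_bigl => j; rewrite -ltnS -(ltnS j) -!subSn ?leq_ord //.
  by rewrite -subn_gt0 -(subn_gt0 j) -!subnDA addnC.
rewrite (big_ord_narrow_leq (leq_subr _ _)) /seqr_mul big_distrl /=.
by apply: eq_bigr => j _; rewrite /coef3 -!subnDA addnC mulrA.
Qed.

Fact seqr_mul1l : left_id (seqr_single 0 1) seqr_mul.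
Proof.
move=> f; apply/funext => m; rewrite /seqr_mul big_ord_recl /= mul1r subn0.
by rewrite big1 ?addr0 // => i _; rewrite /seqr_single /= mul0r.
Qed.

Fact seqr_mul1r : right_id (seqr_single 0 1) seqr_mul.
Proof.
move=> f; apply/funext => m; rewrite seqr_mul_rev big_ord_recl /= mulr1 subn0.
by rewrite big1 ?addr0 // => i _; rewrite /seqr_single /= mulr0.
Qed.

Fact seqr_mulDl : left_distributive seqr_mul +%R.
Proof.
move=> f g h; apply/funext => m.
rewrite -[RHS]/(seqr_mul f h m + seqr_mul g h m) -big_split /=.
by apply: eq_bigr => i _; apply: mulrDl.
Qed.

Fact seqr_mulDr : right_distributive seqr_mul +%R.
Proof.
move=> f g h; apply/funext => m.
rewrite -[RHS]/(seqr_mul f g m + seqr_mul f h m) -big_split /=.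
by apply: eq_bigr => i _; apply: mulrDr.
Qed.

HB.instance Definition _ := GRing.Zmodule_isPzRing.Build (seqring A)
  seqr_mulA seqr_mul1l seqr_mul1r seqr_mulDl seqr_mulDr.

End SeqRing.

(* For a filtration F of A, with F_{-1} = 0, the Rees ring is the direct sum  *)
(* of the F_m, i.e. the ring of finitely supported sequences with m-th term   *)
(* in F_m. Its quotient by the direct sum of the F_{m-1} is the direct sum of *)
(* the F_m / F_{m-1}.                                                         *)
Section Graded.
Variables (A : pzRingType) (F : filtration A).

Definition fil_prev (m : nat) (x : A) : Prop :=
  if m is m'.+1 then F m' x else x = 0.

Definition rees_pred : {pred seqring A} := fun f =>
  `[< (forall m, F m (f m)) /\ exists N, forall m, (N <= m)%N -> f m = 0 >].

Lemma fil_add m x y : F m x -> F m y -> F m (x + y).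
Proof.
move=> Fx Fy; rewrite -[y]opprK -[- y]sub0r; apply: fil_B => //.
by apply: fil_B => //; apply: fil_0.
Qed.

Lemma fil_prev0 m : fil_prev m 0.
Proof. by case: m => //= m; apply: fil_0. Qed.

Lemma fil_prevD m x y : fil_prev m x -> fil_prev m y -> fil_prev m (x + y).
Proof. by case: m => [->->|m] /=; [rewrite addr0 | apply: fil_add]. Qed.

Lemma fil_prevMl l m x y :
  F l x -> fil_prev m y -> fil_prev (l + m)%N (x * y).
Proof.
case: m => [|m] Fx /= Fy; first by rewrite Fy mulr0; apply: fil_prev0.
by rewrite addnS; apply: fil_M.
Qed.

Lemma fil_prevMr l m x y :
  fil_prev l x -> F m y -> fil_prev (l + m)%N (x * y).
Proof.
case: l => [|l] /= Fx Fy; first by rewrite Fx mul0r; apply: fil_prev0.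
exact: fil_M.
Qed.

Lemma rees_single m x : F m x -> seqr_single m x \in rees_pred.
Proof.
move=> Fx; apply/asboolP; rewrite /seqr_single; split=> [k|].
  by case: eqP => [->//|_]; apply: fil_0.
by exists m.+1 => k lt_mk; rewrite gtn_eqF.
Qed.

Fact rees_subring_closed : subring_closed rees_pred.
Proof.
split=> [|f g /asboolP[Ff [M fM]] /asboolP[Fg [N gN]]
         |f g /asboolP[Ff [M fM]] /asboolP[Fg [N gN]]].
- exact/rees_single/fil_1.
- apply/asboolP; split=> [m|]; first exact: fil_B.
  exists (maxn M N) => m; rewrite geq_max => /andP[leM leN].
  by rewrite -[LHS]/(f m - g m) fM // gN // subr0.
apply/asboolP; split=> [m|].
  apply: big_ind; [exact: fil_0 | by move=> *; apply: fil_add|].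
  move=> i _; have /subnKC {1}<- : (i <= m)%N by rewrite -ltnS.
  exact: fil_M.
exists (M + N)%N => m leMN; rewrite -[LHS]/(\sum_(i < m.+1) _).
apply: big1 => i _; have [leM|ltM] := leqP M i; first by rewrite fM ?mul0r.
rewrite gN ?mulr0 // leq_subRL -1?ltnS //.
by apply: leq_trans leMN; rewrite leq_add2r ltnW.
Qed.

HB.instance Definition _ := GRing.isSubringClosed.Build (seqring A) rees_pred
  rees_subring_closed.

Record rees := Rees { rees_val : seqring A; reesP : rees_val \in rees_pred }.

HB.instance Definition _ := [isSub for rees_val].
HB.instance Definition _ := [Choice of rees by <:].
HB.instance Definition _ :=
  GRing.SubChoice_isSubPzRing.Build (seqring A) rees_pred rees
    rees_subring_closed.

Definition in_gr_ideal (f : rees) : Prop :=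
  forall m, fil_prev m (rees_val f m).

Fact gr_ideal0 : in_gr_ideal 0.
Proof. by move=> m; apply: fil_prev0. Qed.

Fact gr_idealD f g : in_gr_ideal f -> in_gr_ideal g -> in_gr_ideal (f + g).
Proof. by move=> If Ig m; apply: fil_prevD. Qed.

Fact gr_idealMl g f : in_gr_ideal f -> in_gr_ideal (g * f).
Proof.
move=> If m; rewrite -[rees_val _ _]/(\sum_(i < m.+1) _).
apply: big_ind; [exact: fil_prev0 | by move=> *; apply: fil_prevD|].
move=> i _; have /subnKC {1}<- : (i <= m)%N by rewrite -ltnS.
by apply: fil_prevMl => //; case: g => g /= /asboolP[].
Qed.

Fact gr_idealMr g f : in_gr_ideal f -> in_gr_ideal (f * g).
Proof.
move=> If m; rewrite -[rees_val _ _]/(\sum_(i < m.+1) _).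
apply: big_ind; [exact: fil_prev0 | by move=> *; apply: fil_prevD|].
move=> i _; have /subnKC {1}<- : (i <= m)%N by rewrite -ltnS.
by apply: fil_prevMr => //; case: g => g /= /asboolP[].
Qed.

Definition gr_ideal : ideal rees :=
  Ideal gr_ideal0 gr_idealD gr_idealMl gr_idealMr.

Definition gr_ring : Type := quot_ring gr_ideal.

HB.instance Definition _ := GRing.PzRing.on gr_ring.

(* the class of x in F_m / F_{m-1} *)
Definition gr_class m x (Fx : F m x) : gr_ring :=
  to_quot gr_ideal (Rees (rees_single Fx)).

End Graded.

Section Presented.
Variables (n : nat) (T : idomainType).

Definition free_alg : Type := {malg T[{fmonom 'I_n}]}.

HB.instance Definition _ := GRing.Lalgebra.on free_alg.

Definition free_var (i : 'I_n) : free_alg := << fmu i >>.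

Definition free_deg_le (m : nat) (f : free_alg) : Prop :=
  forall w, w \in monalg.msupp f -> (fdeg w <= m)%N.

Variable S : free_alg -> Prop.

Definition presented : Type := quot_ring (ideal_gen S).

HB.instance Definition _ := GRing.PzRing.on presented.

Definition pres : free_alg -> presented := to_quot (ideal_gen S).

HB.instance Definition _ := GRing.RMorphism.on pres.

Definition pcst (c : T) : presented := pres c%:A.
Definition pvar (i : 'I_n) : presented := pres (free_var i).

(* The filtration with deg x_i = 1 and deg c = 0 for c in T. *)
Definition deg_fil (m : nat) (x : presented) : Prop :=
  exists2 f, free_deg_le m f & pres f = x.

Lemma free_deg_le0 m : free_deg_le m 0.
Proof. by move=> w; rewrite monalg.msupp0. Qed.

Fact deg_fil0 m : deg_fil m 0.
Proof. by exists 0; [apply: free_deg_le0 | rewrite rmorph0]. Qed.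

Fact deg_filB m x y : deg_fil m x -> deg_fil m y -> deg_fil m (x - y).
Proof.
move=> [f Ff <-] [g Fg <-]; exists (f - g); last by rewrite rmorphB.
by move=> w /(fsubsetP (monalg.msuppB_le _ _)); rewrite inE => /orP[/Ff | /Fg].
Qed.

Fact deg_filS m x : deg_fil m x -> deg_fil m.+1 x.
Proof. by case=> f Ff <-; exists f => // w /Ff /leqW. Qed.

Lemma deg_fil_cst c : deg_fil 0 (pcst c).
Proof.
exists c%:A => // w.
by rewrite -[_%:A]monalg.mul_malgC mulr1 => /(fsubsetP (monalg.msuppC_le _));
  rewrite inE => /eqP->; rewrite fdeg1.
Qed.

Lemma deg_fil_var i : deg_fil 1 (pvar i).
Proof.
exists (free_var i) => // w.
by rewrite /free_var monalg.msuppU1 inE => /eqP->; rewrite fdegU.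
Qed.

Fact deg_fil1 : deg_fil 0 1.
Proof. by have := deg_fil_cst 1; rewrite /pcst scale1r rmorph1. Qed.

Fact deg_filM l m x y :
  deg_fil l x -> deg_fil m y -> deg_fil (l + m) (x * y).
Proof.
move=> [f Ff <-] [g Fg <-]; exists (f * g); last by rewrite rmorphM.
move=> w /monalg.msuppM_le[w1 [w2 [w1f w2g ->]]].
by rewrite fdegM leq_add ?Ff ?Fg.
Qed.

Definition deg_filtration : filtration presented :=
  Filtration deg_fil0 deg_filB deg_filS deg_fil1 deg_filM.

(* Adjoining the constants makes the generated subring a T-subalgebra. *)
Definition power_subalg (L : 'I_n -> nat) : presented -> Prop :=
  subring_gen (fun x =>
    (exists c, x = pcst c) \/ (exists i, x = pvar i ^+ L i)).

(* The centre is isomorphic, as a T-algebra, to T[y_1, ..., y_r] for some r. *)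
Definition center_is_polynomial_ring : Prop :=
  exists r (f : {rmorphism mpoly r T -> presented}),
    [/\ injective f,
        forall c, f (mpolyC r c) = pcst c &
        forall z, central z <-> exists p, f p = z].

Definition center_is (C : presented -> Prop) : Prop :=
  forall z, central z <-> C z.

(* as a left module over the subring C, with a finite basis b *)
Definition finite_free_over (C : presented -> Prop) : Prop :=
  exists r (b : 'I_r -> presented),
    (forall v, exists2 c : 'I_r -> presented,
        forall i, C (c i) & v = \sum_i c i * b i) /\
    (forall c : 'I_r -> presented, (forall i, C (c i)) ->
        \sum_i c i * b i = 0 -> forall i, c i = 0).

End Presented.

Section QuantumAlgebras.
Variables (n : nat) (T : idomainType).
Variables (q a : 'I_n -> 'I_n -> T).

Let x := @free_var n T.

(* only the entries q i j and a i j with i < j are used *)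
Definition skew_relator (f : free_alg n T) : Prop :=
  exists i j : 'I_n,
    (i < j)%N /\ f = x j * x i - q i j *: (x i * x j).

Definition weyl_relator (f : free_alg n T) : Prop :=
  exists i j : 'I_n,
    (i < j)%N /\ f = x j * x i - q i j *: (x i * x j) - (a i j)%:A.

Definition skew_poly_ring : Type := presented skew_relator.
Definition quantum_weyl : Type := presented weyl_relator.

HB.instance Definition _ := GRing.PzRing.on skew_poly_ring.
HB.instance Definition _ := GRing.PzRing.on quantum_weyl.

Definition gr_quantum_weyl : Type := gr_ring (deg_filtration weyl_relator).

HB.instance Definition _ := GRing.PzRing.on gr_quantum_weyl.

(* The natural isomorphism maps x_i to the class of x_i in F_1 / F_0, and     *)
(* c in T to its class in F_0.                                                *)
Definition gr_naturally_skew : Prop :=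
  exists psi : {rmorphism skew_poly_ring -> gr_quantum_weyl},
    [/\ bijective psi,
        forall c, psi (pcst skew_relator c) =
          gr_class (F := deg_filtration weyl_relator) (deg_fil_cst _ c) &
        forall i, psi (pvar skew_relator i) =
          gr_class (F := deg_filtration weyl_relator) (deg_fil_var _ i)].

End QuantumAlgebras.

Section Exponents.
Variables (n : nat) (T : idomainType) (q : 'I_n -> 'I_n -> T).

Definition qfull (i j : 'I_n) : T :=
  if (i < j)%N then q i j else if (j < i)%N then (q j i)^-1 else 1.

Inductive qgroup : T -> Prop :=
| qgroup_gen i j : qgroup (qfull i j)
| qgroup1 : qgroup 1
| qgroupM u v : qgroup u -> qgroup v -> qgroup (u * v)
| qgroupV u : qgroup u -> qgroup u^-1.

(* phi restricts to an injective group morphism from qgroup to C \ {0} *)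
Definition complex_identification (R : realType) (phi : T -> R[i]) : Prop :=
  [/\ phi 1 = 1,
      forall u v, qgroup u -> qgroup v -> phi (u * v) = phi u * phi v &
      forall u v, qgroup u -> qgroup v -> phi u = phi v -> u = v].

(* exp (2 pi sqrt(-1) k / d) *)
Definition cexp2pi (R : realType) (k : int) (d : nat) : R[i] :=
  let t : R := 2 * pi * (k%:~R / d%:R) in (cos t +i* sin t)%C.

Definition exponents_of (R : realType) (phi : T -> R[i])
    (d : 'I_n -> 'I_n -> nat) (k : 'I_n -> 'I_n -> int) : Prop :=
  forall i j,
    [/\ phi (qfull i j) = cexp2pi R (k i j) (d i j),
        (`|k i j| < d i j)%N,
        coprime `|k i j|%N (d i j) &
        k i j = - k j i].

End Exponents.

Section Matrices.
Variables (n : nat) (d : 'I_n -> 'I_n -> nat) (k : 'I_n -> 'I_n -> int).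

Definition Lexp (i : 'I_n) : nat := \big[lcmn/1%N]_(j < n) d i j.

Definition Ybar : 'M[int]_n :=
  \matrix_(i, j) (k i j * (Lexp i)%:Z %/ (d i j)%:Z)%Z.

Definition Ipm (p m : nat) : {set 'I_n} :=
  [set i | (p ^ m %| Lexp i)%N && ~~ (p ^ m.+1 %| Lexp i)%N].

Definition Ybar_pm (p m : nat) : 'M['F_p]_#|Ipm p m| :=
  map_mx (intr : int -> 'F_p) (mxsub enum_val enum_val Ybar).

End Matrices.

(* Main.v *)
Require Import Defs.
From HB Require Import structures.
From mathcomp Require Import all_boot all_order all_algebra.
From mathcomp Require Import finmap.
From mathcomp Require Import ssrcomplements monalg mpoly.
From mathcomp Require Import boolp reals trigo.
From mathcomp Require Import complex.
From mathcomp Require Import ring lra.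

Set Implicit Arguments.
Unset Strict Implicit.
Unset Printing Implicit Defensive.

Import GRing.Theory Num.Theory.
Local Open Scope ring_scope.

(** In both algebras a word in the [x_i] equals a unit times the ordered monomial
    with the same exponents, modulo an error term: [0] in the skew polynomial
    ring, lower filtration degree in the Weyl algebra. Leading terms then show
    that the centre is spanned by the ordered monomials [x^m] with [m] in the
    monoid [M] of the exponents with [prod_j q_ij^(m_j) = 1] for all [i], as soon
    as these monomials are central.

    If the centre of the skew polynomial ring is a polynomial ring, then [M] is
    generated by the [L_i e_i]. Otherwise take [m] in [M] of least degree outside
    the monoid they generate. The coefficients at [m] and at the [L_i e_i], all of
    them atoms of [M], are derivations along the augmentation of the centre, so
    there is a homomorphism from the centre to [T[s][t]] that maps [x^m] to
    [s t + O(t^2)] and every [x_i^(L_i)] to [t + O(t^2)]. This contradicts the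
    multiplicative relation between a power of [x^m] and the [x_i^(L_i)].

    The group generated by [M] modulo the sum of the [L_i Z e_i] has an element
    of order [p] iff some nonzero row vector mod [p], supported on
    the [i] with [p | L_i], is killed by [Ybar]. Mod [p] the matrix [Ybar] is
    block triangular with respect to the [p]-adic valuations of the [L_i], with
    diagonal blocks [Ybar_pm].

    In the Weyl algebra [x_i^(L_i)] is central because the [q_ij]-integer [L_i]
    vanishes: [q_ij] is an [L_i]-th root of unity different from [1]. *)

(** * Exponent lattices and the matrix Ybar *)

Section ExponentLattice.
Variables (n : nat) (d : 'I_n -> 'I_n -> nat) (k : 'I_n -> 'I_n -> int).
Variable D : nat.
Hypothesis d_gt0 : forall i j, (0 < d i j)%N.
Hypothesis d_sym : forall i j, d i j = d j i.
Hypothesis k_skew : forall i j, k i j = - k j i.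
Hypothesis D_gt0 : (0 < D)%N.
Hypothesis L_dvd_D : forall i, (Lexp d i %| D)%N.
Implicit Types (i j : 'I_n) (p m : nat) (al : 'I_n -> nat).

Let L := Lexp d.
Let Y := Ybar d k.
Let YF p : 'M['F_p]_n := map_mx (intr : int -> 'F_p) Y.

Lemma d_dvd_Lexp i j : (d i j %| L i)%N.
Proof. exact: (@biglcmn_sup _ j). Qed.

Lemma Lexp_gt0 i : (0 < L i)%N.
Proof. exact: dvdn_gt0 (L_dvd_D i). Qed.

(** Both sides are [D * k j i / d j i]; the division in [Ybar] is exact because [d j i] divides
    [L j]. *)
Lemma Ybar_mul j i : Y j i * (D %/ L j)%N = k j i * (D %/ d j i)%N.
Proof.
have [e Le] := dvdnP (d_dvd_Lexp j i); have [f Df] := dvdnP (L_dvd_D j).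
rewrite Df mulnK ?Lexp_gt0 // mxE -/(L j) Le mulnA mulnK // PoszM mulrA.
by rewrite mulzK ?eqz_nat -?lt0n // -mulrA -PoszM mulnC.
Qed.

(** The matrix of the fractions [k j i / d j i] is skew-symmetric, and [Y] arises from it by
    multiplying row [j] by [L j]. *)
Lemma Ybar_skew j i : Y j i * L i = - Y i j * L j.
Proof.
have D0 : (D : int) != 0 by rewrite eqz_nat -lt0n.
have DL h : (D : int) = (D %/ L h)%N%:Z * L h by rewrite -PoszM divnK ?L_dvd_D.
have YN : Y j i * (D %/ L j)%N = - (Y i j * (D %/ L i)%N).
  by rewrite !Ybar_mul k_skew d_sym mulNr.
apply: (mulIf D0); transitivity (Y j i * (D %/ L j)%N * (L i * L j)).
  by rewrite [X in _ * X = _](DL j); ring.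
by rewrite YN [X in _ = _ * X](DL i); ring.
Qed.

(** The sum is [D] times the argument, in full turns, of [prod_j q_ij^(al_j)]. Divisibility by the
    common denominator [D] thus says over the integers that this product is [1]. *)
Definition exp_central al :=
  forall i, (D %| \sum_j k i j * (D %/ d i j)%N * (al j)%:Z)%Z.

Definition exp_lattice al := forall i, (L i %| al i)%N.

Lemma exp_centralE al :
  exp_central al <-> forall i, (D %| \sum_j Y j i * (D %/ L j)%N * (al j)%:Z)%Z.
Proof.
have E i : \sum_j k i j * (D %/ d i j)%N * (al j)%:Z
    = - \sum_j Y j i * (D %/ L j)%N * (al j)%:Z.
  by rewrite -sumrN; apply: eq_bigr => j _; rewrite Ybar_mul k_skew d_sym !mulNr.
by split=> Mal i; have := Mal i; rewrite E rpredN.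
Qed.

Lemma intr_Fp_eq0 p z : prime p -> ((z%:~R : 'F_p) == 0) = (p %| z)%Z.
Proof. by move=> /pchar_Fp /dvdz_pcharf->. Qed.

Lemma dvdz_mul_div p (z : int) : (0 < p)%N -> (p %| D)%N ->
  (D %| (D %/ p)%N%:Z * z)%Z = (p %| z)%Z.
Proof.
move=> p0 pD; have DE : (D : int) = (D %/ p)%N%:Z * p by rewrite -PoszM divnK.
transitivity ((D %/ p)%N%:Z * p %| (D %/ p)%N%:Z * z)%Z; first by rewrite -DE.
by rewrite dvdz_mul2l // eqz_nat -lt0n divn_gt0 // dvdn_leq.
Qed.

(** A kernel vector [b] stands for the exponent with entries [L j / p * b j], a class of order
    dividing [p] modulo the lattice; the support condition makes [L j / p] an integer wherever it is
    used. *)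
Definition Ybar_ker_trivial p := forall b : 'rV['F_p]_n,
  (forall i, ~~ (p %| L i)%N -> b 0 i = 0) -> b *m YF p = 0 -> b = 0.

Lemma ker_trivial_of_lattice p : prime p ->
  (forall al, exp_central al -> exp_lattice al) -> Ybar_ker_trivial p.
Proof.
move=> pr_p ML b supp_b bY0; apply/rowP => j0; rewrite mxE; apply/eqP.
apply: contraT => b_neq0.
have pL0 : (p %| L j0)%N.
  by apply: contraNT b_neq0 => /supp_b ->.
have p0 := prime_gt0 pr_p.
have pD : (p %| D)%N := dvdn_trans pL0 (L_dvd_D j0).
pose al j := if (p %| L j)%N then (L j %/ p * nat_of_ord (b 0%R j))%N else 0%N.
have /ML /(_ j0) : exp_central al.
  apply/exp_centralE => i.
  have -> : \sum_j Y j i * (D %/ L j)%N * (al j)%:Z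
      = (D %/ p)%N%:Z * \sum_j (b 0 j : nat)%:Z * Y j i.
    rewrite mulr_sumr; apply: eq_bigr => j _; rewrite /al.
    have [pL|/supp_b->] := boolP (p %| L j)%N; last by rewrite mul0r !mulr0.
    rewrite PoszM mulrA -[Y j i * _ * _]mulrA -PoszM.
    rewrite -[in RHS](divnK (L_dvd_D j)) -muln_divA // -/(L j).
    by rewrite !PoszM; ring.
  rewrite dvdz_mul_div // -intr_Fp_eq0 // rmorph_sum /=.
  have /rowP/(_ i) := bY0; rewrite !mxE => YE; apply/eqP; rewrite -[RHS]YE.
  apply: eq_bigr => j _.
  by rewrite intrM -pmulrn natr_Zp [YF p j i]mxE.
(* As [0 < b j0 < p], the entry [al j0] lies strictly between [0] and [L j0], so [L j0] cannot
   divide it. *)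
rewrite /al pL0 => /dvdn_leq; rewrite muln_gt0.
have -> : (0 < L j0 %/ p)%N by rewrite divn_gt0 // dvdn_leq ?Lexp_gt0.
have b0 : (0 < nat_of_ord (b 0%R j0))%N by rewrite lt0n.
rewrite b0 => /(_ isT); rewrite leqNgt => /negP[].
rewrite -[X in (_ < X)%N](divnK pL0) ltn_mul2l divn_gt0 // dvdn_leq ?Lexp_gt0 //=.
by rewrite -[X in (_ < X)%N](Fp_cast pr_p) ltn_ord.
Qed.

(** Let [N] be the least positive integer with [N * al] in the lattice. If a prime [p] divides [N],
    then [al' = N / p * al] has [p * al'] in the lattice and yields a kernel vector mod [p]; its
    vanishing puts [al'] in the lattice, against minimality. *)
Lemma lattice_of_ker_trivial :
  (forall p, prime p -> Ybar_ker_trivial p) ->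
  forall al, exp_central al -> exp_lattice al.
Proof.
move=> kerY al Mal.
have exN : exists N, (0 < N)%N && [forall i, L i %| N * al i]%N.
  by exists D; rewrite D_gt0; apply/forallP => i; rewrite dvdn_mulr.
case: (ex_minnP exN) => N /andP[N0 /forallP LN] minN.
have [N1|N1] := leqP N 1.
  move=> i; have := LN i; rewrite (_ : N = 1%N) ?mul1n //.
  by apply/eqP; rewrite eqn_leq N1.
pose p := pdiv N; have pr_p : prime p := pdiv_prime N1.
have p0 := prime_gt0 pr_p; have pN : (p %| N)%N := pdiv_dvd N.
pose al' j := (N %/ p * al j)%N.
have pal' i : (L i %| p * al' i)%N by rewrite mulnA mulnC [(p * _)%N]mulnC divnK // mulnC.
have Mal' : exp_central al'.
  move=> i; rewrite (_ : \sum_j _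
      = (N %/ p)%N%:Z * (\sum_j k i j * (D %/ d i j)%N * (al j)%:Z)).
    by rewrite dvdz_mull.
  by rewrite mulr_sumr; apply: eq_bigr => j _; rewrite PoszM mulrCA.
have divL i : (p %| L i)%N -> (L i %/ p %| al' i)%N.
  by move=> pL; rewrite -(@dvdn_pmul2l p) // mulnC divnK.
pose c j := if (p %| L j)%N then (al' j %/ (L j %/ p))%N else 0%N.
have c_al j : (p %| L j)%N -> al' j = (L j %/ p * c j)%N.
  by move=> pL; rewrite /c pL mulnC divnK ?divL.
pose b : 'rV['F_p]_n := \row_j (c j)%:R.
suff b0 : b = 0.
  have /minN : (0 < N %/ p)%N && [forall i, L i %| N %/ p * al i]%N.
    rewrite divn_gt0 // dvdn_leq //=; apply/forallP => i; rewrite -/(al' i).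
    have [pL|pL] := boolP (p %| L i)%N; last first.
      by rewrite -(@Gauss_dvdr _ p) // coprime_sym prime_coprime.
    rewrite c_al // -{1}(divnK pL) dvdn_mul //.
    have /rowP/(_ i) := b0; rewrite !mxE => /eqP.
    by rewrite -(dvdn_pcharf (pchar_Fp pr_p)).
  by rewrite leqNgt ltn_Pdiv // prime_gt1.
apply: (kerY p pr_p) => [i pL|]; first by rewrite mxE /c (negbTE pL).
apply/rowP => i; rewrite !mxE; apply/eqP.
transitivity (((\sum_j (c j)%:Z * Y j i)%:~R : 'F_p) == 0).
  rewrite rmorph_sum /=; congr (_ == 0); apply: eq_bigr => j _.
  by rewrite rmorphM /= !mxE -pmulrn.
rewrite intr_Fp_eq0 //; have [pD|pD] := boolP (p %| D)%N; last first.
  rewrite big1 ?dvdz0 // => j _; rewrite /c ifF ?mul0r //.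
  by apply: contraNF pD => /dvdn_trans; apply; apply: L_dvd_D.
rewrite -(dvdz_mul_div _ p0 pD); have /exp_centralE/(_ i) := Mal'.
rewrite mulr_sumr.
(* The kernel sum and the centrality sum are compared term by term: they agree where [p] divides
   [L j], and elsewhere [L j] divides [al' j], so that the difference is a multiple of [D]. *)
rewrite -[X in (_ %| X)%Z -> _](subrK (\sum_j (D %/ p)%N%:Z * ((c j)%:Z * Y j i))).
rewrite rpredDl // -sumrB; apply: rpred_sum => j _.
have [pL|pL] := boolP (p %| L j)%N.
  rewrite c_al // (_ : _ - _ = 0) ?dvdz0 //; apply/eqP; rewrite subr_eq0; apply/eqP.
  rewrite PoszM mulrA -[Y j i * _ * _]mulrA -PoszM.
  rewrite -[in RHS](divnK (L_dvd_D j)) -muln_divA // -/(L j).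
  by rewrite !PoszM; ring.
rewrite /c (negbTE pL) mul0r mulr0 subr0 -mulrA dvdz_mull // -PoszM.
have La : (L j %| al' j)%N by rewrite -(@Gauss_dvdr _ p) // coprime_sym prime_coprime.
by rewrite dvdzE /= -{1}(divnK (L_dvd_D j)) dvdn_mul.
Qed.

(** By [Ybar_skew] the product [Y j i * L i] is a multiple of [L j], so the missing factor [p] must
    come from [Y j i]. *)
Lemma YF_triangular p i j : prime p -> (logn p (L i) < logn p (L j))%N -> YF p j i = 0.
Proof.
move=> pr_p lt_ij; rewrite mxE; apply/eqP; rewrite intr_Fp_eq0 //.
rewrite dvdzE /=; have [-> //|Y0] := posnP `|Y j i|%N.
rewrite -[p]expn1 pfactor_dvdn //.
have : (p ^ logn p (L j) %| `|Y j i| * L i)%N.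
  have /(congr1 absz) := Ybar_skew j i; rewrite !abszM /= => ->.
  by rewrite dvdn_mull // pfactor_dvdnn.
rewrite pfactor_dvdn ?muln_gt0 ?Y0 ?Lexp_gt0 // lognM ?Lexp_gt0 //.
by move=> /(leq_trans lt_ij); rewrite -[X in (X < _)%N]add0n ltn_add2r.
Qed.

Lemma mem_Ipm p m i : prime p -> (i \in Ipm d p m) = (logn p (L i) == m).
Proof.
by move=> pr_p; rewrite inE !pfactor_dvdn ?Lexp_gt0 // -ltnNge eqn_leq andbC ltnS.
Qed.

Lemma logn_Lexp_gt0 p i : prime p -> (0 < logn p (L i))%N = (p %| L i)%N.
Proof. by move=> pr_p; rewrite -[X in (X %| _)%N]expn1 pfactor_dvdn ?Lexp_gt0. Qed.

Lemma Ybar_pmE p m (i j : 'I_#|Ipm d p m|) :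
  Ybar_pm d k p m i j = YF p (enum_val i) (enum_val j).
Proof. by rewrite !mxE. Qed.

(* The blocks of [Y] are triangular for the grading by [logn p (L i)], and a
   vanishing diagonal block is completed to a kernel vector by surjectivity of
   [Y] on the vectors supported in higher degrees. *)
Lemma det_neq0_of_ker_trivial p m : prime p -> (0 < m)%N ->
  Ybar_ker_trivial p -> \det (Ybar_pm d k p m) != 0.
Proof.
move=> pr_p m0 kerY; apply/negP => /det0P[g g0 gY].
pose A := [set u : 'rV['F_p]_n | [forall i, (logn p (L i) <= m)%N ==> (u 0 i == 0)]].
have AP (u : 'rV['F_p]_n) :
    reflect (forall i, (logn p (L i) <= m)%N -> u 0 i = 0) (u \in A).
  rewrite inE; apply: (iffP forallP) => uA i; first by move=> /(implyP (uA i))/eqP.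
  by apply/implyP => /uA ->.
have subA : [set u *m YF p | u in A] \subset A.
  apply/subsetP => _ /imsetP[u /AP uA ->]; apply/AP => i im.
  rewrite mxE big1 // => j _; have [jm|jm] := leqP (logn p (L j)) m.
    by rewrite uA ?mul0r.
  by rewrite YF_triangular ?mulr0 //; apply: leq_ltn_trans jm.
have injA : {in A &, injective (mulmxr (YF p))}.
  move=> u v /AP uA /AP vA /= uv; apply/eqP; rewrite -subr_eq0; apply/eqP.
  apply: kerY => [i|]; last by rewrite mulmxBl uv subrr.
  by rewrite -logn_Lexp_gt0 // -eqn0Ngt => /eqP i0; rewrite !mxE uA ?vA ?subrr ?i0.
(* An injective self-map of the finite set [A] is onto. *)
have eqA : [set u *m YF p | u in A] = A.
  by apply/eqP; rewrite eqEcard subA (card_in_imset injA) leqnn.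
pose v : 'rV['F_p]_n := \row_j \sum_i g 0 i *+ (enum_val i == j).
have vE (i : 'I_#|Ipm d p m|) : v 0 (enum_val i) = g 0 i.
  rewrite mxE (bigD1 i) //= eqxx big1 ?addr0 // => i' i'i.
  by rewrite (inj_eq enum_val_inj) (negbTE i'i).
have v0 j : j \notin Ipm d p m -> v 0 j = 0.
  move=> jI; rewrite mxE big1 // => i _; case: eqP => // ij.
  by rewrite -ij enum_valP in jI.
have vYA : v *m YF p \in A.
  (* At level [m] the image vanishes because [g] kills the diagonal block, at lower levels by
     triangularity. *)
  apply/AP => i im; rewrite mxE (bigID (mem (Ipm d p m))) /=.
  rewrite [X in _ + X]big1 ?addr0 => [|j /v0->]; last by rewrite mul0r.
  rewrite big_enum_val /=; move: im; rewrite leq_eqVlt => /orP[im|im].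
    have /rowP := gY; rewrite -mem_Ipm // in im.
    move/(_ (enum_rank_in im i)); rewrite !mxE => YE; rewrite -[RHS]YE.
    apply: eq_bigr => j _.
    by rewrite vE Ybar_pmE enum_rankK_in.
  rewrite big1 // => j _; rewrite YF_triangular ?mulr0 //.
  by have := enum_valP j; rewrite mem_Ipm // => /eqP ->.
have [u uA vu] : exists2 u : 'rV['F_p]_n,
    forall i, (logn p (L i) <= m)%N -> u 0 i = 0 & v *m YF p = u *m YF p.
  by move: vYA; rewrite -eqA => /imsetP[u /AP uA vu]; exists u.
have vuE : v = u.
  apply/eqP; rewrite -subr_eq0; apply/eqP; apply: kerY => [i|].
    rewrite -logn_Lexp_gt0 // -eqn0Ngt => /eqP i0.
    rewrite mxE v0 ?mem_Ipm // ?i0 ?(ltn_eqF m0) // mxE uA ?i0 //.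
    by rewrite subrr.
  by rewrite mulmxBl vu subrr.
case/eqP: g0; apply/rowP => i; rewrite mxE -vE vuE uA //.
by have := enum_valP i; rewrite mem_Ipm // => /eqP ->.
Qed.

(** Restrict a nonzero kernel vector to the lowest level of its support. Higher levels do not
    contribute to the columns of that level, so the restriction is a nonzero kernel vector of a
    diagonal block. *)
Lemma ker_trivial_of_det_neq0 p : prime p ->
  (forall m, (0 < m)%N -> Ipm d p m != set0 -> \det (Ybar_pm d k p m) != 0) ->
  Ybar_ker_trivial p.
Proof.
move=> pr_p detY b supp_b bY; apply/rowP => j1; rewrite mxE; apply/eqP.
apply: contraT => bj1.
case: (@arg_minnP _ j1 (fun j => b 0 j != 0) (fun j => logn p (L j)) bj1).
move=> j0 bj0 min0; set m := logn p (L j0).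
have j0I : j0 \in Ipm d p m by rewrite mem_Ipm.
have m0 : (0 < m)%N.
  by rewrite logn_Lexp_gt0 //; apply: contraNT bj0 => /supp_b->.
have I0 : Ipm d p m != set0 by apply/set0Pn; exists j0.
have /negP[] := detY m m0 I0.
apply/det0P; exists (\row_i b 0 (enum_val i)).
  apply: contraNneq bj0 => /rowP/(_ (enum_rank_in j0I j0)).
  by rewrite !mxE enum_rankK_in // => ->.
apply/rowP => i; have /rowP/(_ (enum_val i)) := bY; rewrite !mxE.
rewrite (bigID (mem (Ipm d p m))) /= addrC big1 ?add0r => [YE|j jI].
  by rewrite -[RHS]YE [RHS]big_enum_val; apply: eq_bigr => j _; rewrite mxE Ybar_pmE.
have [->|bj] := eqVneq (b 0 j) 0; first by rewrite mul0r.
rewrite YF_triangular ?mulr0 //; have := enum_valP i; rewrite mem_Ipm // => /eqP->.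
by rewrite ltn_neqAle eq_sym -mem_Ipm // jI min0.
Qed.

Lemma exp_central_latticeP :
  (forall al, exp_central al -> exp_lattice al) <->
  (forall p m, prime p -> (0 < m)%N -> Ipm d p m != set0 ->
     \det (Ybar_pm d k p m) != 0).
Proof.
split=> [ML p m pr_p m0 _|detY].
  by apply: det_neq0_of_ker_trivial => //; apply: ker_trivial_of_lattice.
apply: lattice_of_ker_trivial => p pr_p.
by apply: ker_trivial_of_det_neq0 => // m; apply: detY.
Qed.

End ExponentLattice.

(** * Roots of unity *)

Section ComplexExponential.
Variable R : realType.
Implicit Types (a b : int) (D : nat).

Lemma cexp2piD a b D : cexp2pi R (a + b) D = cexp2pi R a D * cexp2pi R b D.
Proof.
rewrite /cexp2pi intrD (mulrDl a%:~R) (mulrDr (2 * pi)) cosD sinD.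
by rewrite [sin _ * _ + _]addrC.
Qed.

Lemma cexp2pi0 D : cexp2pi R 0 D = 1.
Proof. by rewrite /cexp2pi rmorph0 mul0r mulr0 cos0 sin0. Qed.

Lemma cexp2pi_divr k d D : (0 < D)%N -> (d %| D)%N ->
  cexp2pi R k d = cexp2pi R (k * (D %/ d)%N) D.
Proof.
move=> D0 /dvdnP[e De]; move: D0; rewrite De muln_gt0 => /andP[e0 d0].
rewrite /cexp2pi mulnK // intrM -pmulrn mulnC natrM -mulf_div divff ?mulr1 //.
by rewrite pnatr_eq0 -lt0n.
Qed.

Lemma cexp2piDD D : (0 < D)%N -> cexp2pi R D D = 1.
Proof.
move=> D0; rewrite /cexp2pi divff ?pnatr_eq0 -?lt0n // mulr1.
rewrite mulr_natl; have := cosD2pi (0 : R); have := sinD2pi (0 : R).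
by rewrite !add0r cos0 sin0 => -> ->.
Qed.

(** Writing the argument as [2 u] with [0 < u < pi], the real part is [1 - 2 sin^2 u < 1]. *)
Lemma cexp2pi_neq1 (m D : nat) : (0 < m < D)%N -> cexp2pi R m D != 1.
Proof.
move=> /andP[m0 mD]; apply/eqP => /(congr1 (@complex.Re R)).
have D0 : (0 < D)%N by apply: leq_trans mD.
rewrite /cexp2pi /=; set t : R := _ * (_ / _).
have /= tE : t = (@pi R * (m%:R / D%:R)) *+ 2 by rewrite -mulr_natl mulrA.
have u_in : 0 < @pi R * (m%:R / D%:R) < @pi R.
  have x0 : 0 < m%:R / D%:R :> R by rewrite divr_gt0 ?ltr0n.
  have x1 : m%:R / D%:R < 1 :> R by rewrite ltr_pdivrMr ?ltr0n // mul1r ltr_nat.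
  apply/andP; split; first by apply: mulr_gt0 => //; apply: pi_gt0.
  by rewrite -[X in _ < X]mulr1 ltr_pM2l //; apply: pi_gt0.
have := exprn_gt0 2 (sin_gt0_pi u_in).
rewrite tE cos_mulr2n cos2sin2; lra.
Qed.

Lemma cexp2pi_eq1 a D : (0 < D)%N -> (cexp2pi R a D == 1) = (D %| a)%Z.
Proof.
move=> D0; have D1 : (D : int) != 0 by rewrite eqz_nat -lt0n.
have cN b : cexp2pi R b D = 1 -> cexp2pi R (- b) D = 1.
  by move=> b1; have := cexp2piD b (- b) D; rewrite subrr cexp2pi0 b1 mul1r.
have cMn (e : nat) : cexp2pi R (e%:Z * D) D = 1.
  elim: e => [|e IHe]; first by rewrite mul0r cexp2pi0.
  by rewrite -addn1 PoszD mulrDl mul1r cexp2piD IHe cexp2piDD // mulr1.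
have cM b : cexp2pi R (b * D) D = 1.
  by case: b => e; [exact: cMn | rewrite NegzE mulNr; apply/cN/cMn].
apply/idP/idP => [|/dvdzP[b ->]]; last by rewrite cM.
rewrite {1}(divz_eq a D) cexp2piD cM mul1r => mod1.
have aD : (a %% D)%Z < D by rewrite ltz_pmod.
apply/dvdz_mod0P; move: mod1 (modz_ge0 a D1) aD.
case: (a %% D)%Z => // m mod1 _; rewrite ltz_nat => mD.
apply/eqP; rewrite eqz_nat; apply: contraLR mod1; rewrite -lt0n => m0.
by apply: cexp2pi_neq1; rewrite m0 mD.
Qed.
End ComplexExponential.

Lemma qfull_prod_eq1 (R : realType) (T : idomainType) (n : nat)
    (q : 'I_n -> 'I_n -> T) (d : 'I_n -> 'I_n -> nat) (k : 'I_n -> 'I_n -> int)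
    (phi : T -> R[i]) (D : nat) (i : 'I_n) (m : 'I_n -> nat) :
  complex_identification q phi -> exponents_of q phi d k ->
  (0 < D)%N -> (forall i j, d i j %| D)%N ->
  (\prod_j qfull q i j ^+ m j == 1)
    = (D %| \sum_j k i j * (D %/ d i j)%N * (m j)%:Z)%Z.
Proof.
move=> [phi1 phiM phi_inj] k_exp D0 dD; rewrite -(cexp2pi_eq1 R) //.
(* [phi] is known to be multiplicative and injective only on [qgroup], so membership is carried
   along with the exponent. *)
pose P u x := qgroup q u /\ phi u = cexp2pi R x D.
have P1 : P 1 0 by split; [exact: qgroup1 | rewrite phi1 cexp2pi0].
have PM u v x y : P u x -> P v y -> P (u * v) (x + y).
  move=> [qu ux] [qv vy]; split; first exact: qgroupM.
  by rewrite phiM // ux vy cexp2piD.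
have PX u x e : P u x -> P (u ^+ e) (x * e%:Z).
  move=> Pux; elim: e => [|e IHe]; first by rewrite mulr0.
  by rewrite exprS -add1n PoszD mulrDr mulr1; apply: PM.
have PQ j : P (qfull q i j) (k i j * (D %/ d i j)%N).
  split; first exact: qgroup_gen.
  by have [-> _ _ _] := k_exp i j; apply: cexp2pi_divr.
have [qP pE] : P (\prod_j qfull q i j ^+ m j)
    (\sum_j k i j * (D %/ d i j)%N * (m j)%:Z).
  by apply: (big_rec2 P) => // j u x _; apply: PM; apply: PX.
rewrite -pE; apply/eqP/eqP => [->//|pu].
by apply: phi_inj => //; [exact: qgroup1 | rewrite pu phi1].
Qed.

(** * Straightening into ordered monomials *)

Section MonomialEvaluation.
Variables (n : nat) (T : idomainType) (A : pzRingType).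
Variables (C : {rmorphism T -> A}) (X : 'I_n -> A).
Implicit Types (i j : 'I_n) (c : T) (m : 'X_{1..n}) (p : mpoly n T).

Definition pmon m : A := \prod_i X i ^+ m i.

Definition pword (w : seq 'I_n) : A := \prod_(i <- w) X i.

(* [mmap] does not apply: it requires [1 != 0] in the target. *)
Definition peval p : A := \sum_(m <- msupp p) C p@_m * pmon m.

Lemma peval_bounded K p : (msize p <= K)%N ->
  peval p = \sum_(m : 'X_{1..n < K}) C p@_m * pmon m.
Proof.
move=> le_pK; rewrite /peval (big_mksub 'X_{1..n < K}) ?msupp_uniq //=; last first.
  by move=> x /msize_mdeg_lt /leq_trans; apply.
rewrite big_rmcond //= => j /memN_msupp_eq0 ->.
by rewrite rmorph0 mul0r.
Qed.

Fact peval_zmod_morphism : zmod_morphism peval.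
Proof.
move=> p q; have [K] := ubnP (maxn (msize (p - q)) (maxn (msize p) (msize q))).
rewrite !gtn_max => /and3P[/ltnW pqK /ltnW pK /ltnW qK].
rewrite !(@peval_bounded K) // -sumrB; apply: eq_bigr => m _.
by rewrite mcoeffB rmorphB mulrBl.
Qed.

HB.instance Definition _ := GRing.isZmodMorphism.Build (mpoly n T) A peval
  peval_zmod_morphism.

Lemma pevalZ c p : peval (c *: p) = C c * peval p.
Proof.
have [K] := ubnP (maxn (msize (c *: p)) (msize p)).
rewrite gtn_max => /andP[/ltnW cpK /ltnW pK].
rewrite !(@peval_bounded K) // mulr_sumr; apply: eq_bigr => m _.
by rewrite mcoeffZ rmorphM mulrA.
Qed.

Lemma pevalX m : peval 'X_[m] = pmon m.
Proof. by rewrite /peval msuppX big_seq1 mcoeffX eqxx rmorph1 mul1r. Qed.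

Lemma pmon0 : pmon 0%MM = 1.
Proof. by rewrite /pmon big1 // => i _; rewrite mnmE. Qed.

Lemma pevalC c : peval c%:MP = C c.
Proof. by rewrite -[c%:MP]mulr1 mul_mpolyC pevalZ -mpolyX0 pevalX pmon0 mulr1. Qed.

End MonomialEvaluation.

Definition word_mnm n (w : seq 'I_n) : 'X_{1..n} := (\sum_(i <- w) U_(i))%MM.

Lemma mdeg_word_mnm n (w : seq 'I_n) : mdeg (word_mnm w) = size w.
Proof.
by rewrite mdeg_sum (eq_bigr (fun=> 1%N)) ?sum1_size // => i _; rewrite mdeg1.
Qed.

Section Filtered.
Variables (A : pzRingType) (F : filtration A).
Implicit Types (k l : nat) (x : A).

Lemma fil_leq l k x : (l <= k)%N -> F l x -> F k x.
Proof.
move=> /subnKC <-; elim: (k - l)%N => [|e IHe] Fx; first by rewrite addn0.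
by rewrite addnS; apply/fil_S/IHe.
Qed.

Lemma fil_sum (I : eqType) (r : seq I) (f : I -> A) k :
  (forall i, i \in r -> F k (f i)) -> F k (\sum_(i <- r) f i).
Proof.
move=> Ff; rewrite big_seq; elim/big_ind: _ => [||i /Ff//]; first exact: fil_0.
by move=> x y Fx Fy; apply: fil_add.
Qed.

Lemma fil_exp k x e : F k x -> F (e * k)%N (x ^+ e).
Proof.
move=> Fx; elim: e => [|e IHe]; first exact: fil_1.
by rewrite exprS mulSn; apply: fil_M.
Qed.

End Filtered.

(* [E k] is an error term for elements of [F k]: it is instantiated by [0] in the
   skew polynomial ring and by the preceding step of the filtration in the Weyl
   algebra. *)
Section Straightening.
Variables (n : nat) (T : idomainType) (A : pzRingType) (F : filtration A).
Variables (C : {rmorphism T -> A}) (X : 'I_n -> A).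
Hypothesis C_comm : forall c x, x * C c = C c * x.
Hypothesis F_C : forall c, F 0 (C c).
Hypothesis F_X : forall i, F 1 (X i).
Local Notation pmon := (pmon X).
Local Notation pword := (pword X).
Local Notation peval := (peval C X).
Implicit Types (i j : 'I_n) (c : T) (m : 'X_{1..n}) (w : seq 'I_n) (k l : nat).
Implicit Types (x y : A).

Lemma fil_CM c k x : F k x -> F k (C c * x).
Proof. by move=> Fx; rewrite -[k]add0n; apply: fil_M. Qed.

Lemma fil_X_exp i e : F e (X i ^+ e).
Proof. by rewrite -[e in F e _]muln1; apply: fil_exp. Qed.

Lemma fil_pmon m : F (mdeg m) (pmon m).
Proof.
rewrite mdegE /pmon; elim/big_rec2: _ => [|i s x _ Fx]; first exact: fil_1.
exact/fil_M/Fx/fil_X_exp.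
Qed.

Lemma fil_peval p k :
  (forall m, m \in msupp p -> (mdeg m <= k)%N) -> F k (peval p).
Proof.
move=> pk; apply: fil_sum => m /pk mk.
exact/fil_CM/(fil_leq mk)/fil_pmon.
Qed.

Variables (Q : 'I_n -> 'I_n -> T) (E : nat -> A -> Prop).
Hypothesis Q_unit : forall i j, Q i j \is a GRing.unit.
Hypothesis E0 : forall k, E k 0.
Hypothesis ED : forall k x y, E k x -> E k y -> E k (x + y).
Hypothesis EMl : forall l k x y, F l x -> E k y -> E (l + k)%N (x * y).
Hypothesis EMr : forall l k x y, E l x -> F k y -> E (l + k)%N (x * y).
Hypothesis E_swap : forall i j, E 2 (X j * X i - C (Q i j) * (X i * X j)).

Let EC c k x : E k x -> E k (C c * x).
Proof. by move=> Ex; rewrite -[k]add0n; apply: EMl. Qed.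

Let CA c x y : x * (C c * y) = C c * (x * y).
Proof. by rewrite mulrA C_comm mulrA. Qed.

(** Moving [X i] past [x] costs the scalar [c], modulo the error term in degree [k.+1]. Such data
    multiply, so ordered monomials reduce to the variables, where [E_swap] applies. *)
Let swap_upto i k x c := F k x /\ E k.+1 (x * X i - C c * (X i * x)).

Let swap_upto1 i : swap_upto i 0 1 1.
Proof. by split; [exact: fil_1 | rewrite rmorph1 !(mul1r, mulr1) subrr]. Qed.

Let swap_uptoM i k l x y c e :
  swap_upto i k x c -> swap_upto i l y e -> swap_upto i (k + l)%N (x * y) (c * e).
Proof.
move=> [Fx Ex] [Fy Ey]; split; first exact: fil_M.
have -> : x * y * X i - C (c * e) * (X i * (x * y))
    = x * (y * X i - C e * (X i * y))
      + C e * ((x * X i - C c * (X i * x)) * y).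
  by rewrite mulrBr mulrBl mulrBr CA mulrC rmorphM -!mulrA addrA subrK.
apply: ED; first by rewrite -addnS; apply: EMl.
by apply: EC; rewrite -addSn; apply: EMr.
Qed.

Let swap_uptoX i k x c e :
  swap_upto i k x c -> swap_upto i (e * k)%N (x ^+ e) (c ^+ e).
Proof.
move=> xc; elim: e => [|e IHe]; first exact: swap_upto1.
by rewrite mulSn !exprS; apply: swap_uptoM.
Qed.

Let swap_upto_prod i (m : 'X_{1..n}) w :
  swap_upto i (\sum_(j <- w) m j)%N (\prod_(j <- w) X j ^+ m j)
    (\prod_(j <- w) Q i j ^+ m j).
Proof.
elim: w => [|j w IHw]; first by rewrite !big_nil; apply: swap_upto1.
rewrite !big_cons; apply: swap_uptoM => //; rewrite -[X in swap_upto _ X]muln1.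
by apply: swap_uptoX; split; [exact: F_X | exact: E_swap].
Qed.

Lemma pmon_mulX_upto i m : E (mdeg m).+1
  (pmon m * X i - C (\prod_j Q i j ^+ m j) * (X i * pmon m)).
Proof. by rewrite mdegE; have [] := swap_upto_prod i m (index_enum 'I_n). Qed.

(** Only the powers of the variables listed before [i] have to be crossed. This costs a product of
    units [Q i j], whose inverse is [u]. *)
Lemma mulX_pmon_upto i m : exists2 u, u \is a GRing.unit &
  E (mdeg m).+1 (X i * pmon m - C u * pmon (U_(i) + m)%MM).
Proof.
have := mem_index_enum i; have := index_enum_uniq 'I_n.
rewrite mdegE /pmon => Uw iw; case/path.splitPr: iw Uw => w1 w2.
rewrite cat_uniq /= => /and4P[_ /norP[iw1 _] iw2 _].
have [Fw1 Ew1] := swap_upto_prod i m w1.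
set c := \prod_(j <- w1) Q i j ^+ m j in Ew1.
have c_unit : c \is a GRing.unit.
  rewrite /c; elim/big_ind: _ => [||j _]; rewrite ?unitr1 ?unitrX //.
  by move=> b e; rewrite unitrM => -> ->.
exists c^-1; first by rewrite unitrV.
have Fw2 : F (\sum_(j <- w2) m j)%N (\prod_(j <- w2) X j ^+ m j).
  by have [] := swap_upto_prod i m w2.
rewrite !big_cat /= !big_cons mnmDE mnm1E eqxx add1n exprS.
have eqw w : i \notin w ->
    \prod_(j <- w) X j ^+ (U_(i) + m)%MM j = \prod_(j <- w) X j ^+ m j.
  move=> iw; apply: eq_big_seq => j jw; rewrite mnmDE mnm1E; case: eqP => // ij.
  by rewrite ij jw in iw.
rewrite !eqw //.
set y1 := \prod_(j <- w1) X j ^+ m j in Ew1 *; set y2 := \prod_(j <- w2) _.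
rewrite (_ : _ - _ = C (- c^-1) * ((y1 * X i - C c * (X i * y1)) * (X i ^+ m i * y2))).
  apply: EC; rewrite -addSn; apply: EMr => //.
  by apply: fil_M => //; apply: fil_X_exp.
rewrite mulrBl mulrBr rmorphN !mulNr opprK addrC !mulrA -(rmorphM C) mulVr //.
by rewrite rmorph1 mul1r.
Qed.

Lemma pword_upto w : exists2 u, u \is a GRing.unit &
  E (size w) (pword w - C u * pmon (word_mnm w)).
Proof.
elim: w => [|i w [u u_unit Ew]].
  by exists 1; rewrite ?unitr1 // /pword /word_mnm !big_nil pmon0 rmorph1 mulr1 subrr.
have [v v_unit] := mulX_pmon_upto i (word_mnm w); rewrite mdeg_word_mnm => Ei.
exists (u * v); first by rewrite unitrM u_unit.
rewrite /pword /word_mnm !big_cons -/(word_mnm w) -/(pword w).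
have -> : X i * pword w - C (u * v) * pmon (U_(i) + word_mnm w)%MM
    = X i * (pword w - C u * pmon (word_mnm w))
      + C u * (X i * pmon (word_mnm w) - C v * pmon (U_(i) + word_mnm w)%MM).
  by rewrite !mulrBr CA addrA subrK mulrA -(rmorphM C).
apply: ED; last exact: EC.
by rewrite -[size _]/(1 + size w)%N; apply: EMl.
Qed.

End Straightening.

(** * Centres of filtered algebras with a monomial basis *)

Section CentralPowers.
Variables (n : nat) (T : idomainType) (A : pzRingType).
Variables (C : {rmorphism T -> A}) (X : 'I_n -> A).
Hypothesis C_comm : forall c x, x * C c = C c * x.
Local Notation pmon := (pmon X).
Local Notation peval := (peval C X).
Implicit Types (i j : 'I_n) (c : T) (m : 'X_{1..n}) (p q : mpoly n T).

Lemma centralM (x y : A) : central x -> central y -> central (x * y).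
Proof. by move=> cx cy z; rewrite /GRing.comm -mulrA cy mulrA cx mulrA. Qed.

Lemma central1 : central (1 : A).
Proof. by move=> z; rewrite /GRing.comm mul1r mulr1. Qed.

Lemma centralX (x : A) e : central x -> central (x ^+ e).
Proof.
move=> cx; elim: e => [|e IHe]; first exact: central1.
by rewrite exprS; apply: centralM.
Qed.

Lemma central_sum (I : eqType) (r : seq I) (f : I -> A) :
  (forall a, a \in r -> central (f a)) -> central (\sum_(a <- r) f a).
Proof.
move=> cf y; rewrite /GRing.comm mulr_suml mulr_sumr.
by apply: eq_big_seq => a /cf; apply.
Qed.

Lemma central_cst c : central (C c).
Proof. by move=> y; rewrite /GRing.comm C_comm. Qed.

Lemma central_of_vars x : (forall y, exists p, y = peval p) ->
  (forall i, x * X i = X i * x) -> central x.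
Proof.
move=> peval_surj xX y; have [p ->] := peval_surj y.
rewrite /GRing.comm mulr_sumr mulr_suml; apply: eq_bigr => m _.
rewrite mulrA C_comm -!mulrA; congr (_ * _).
rewrite /pmon; elim/big_rec: _ => [|i z _ IHz]; first by rewrite mul1r mulr1.
rewrite -[RHS]mulrA -IHz !mulrA; congr (_ * _).
by elim: (m i) => [|e IHe]; rewrite ?mul1r ?mulr1 // exprS mulrA xX -!mulrA IHe.
Qed.

Lemma pmonD m m' : (forall i, central (X i ^+ m i)) ->
  central (pmon m) /\ pmon (m + m')%MM = pmon m * pmon m'.
Proof.
move=> cm; rewrite /pmon.
elim/big_rec3: _ => [|i x y z _ [cy ->]].
  by split; [exact: central1 | rewrite mulr1].
split; first exact: centralM.
by rewrite mnmDE exprD -!mulrA; congr (_ * _); rewrite !mulrA -cy.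
Qed.

(** In general [peval] is only additive, since products of ordered monomials need reordering;
    central powers in the left factor can be inserted anywhere at no cost. *)
Lemma peval_mul p q :
  (forall m, m \in msupp p -> forall i, central (X i ^+ m i)) ->
  peval (p * q) = peval p * peval q.
Proof.
move=> cp; rewrite mpolyME raddf_sum big_allpairs /=.
have E r : peval r = \sum_(m <- msupp r) C r@_m * pmon m by [].
rewrite [peval p]E mulr_suml; apply: eq_big_seq => m pm.
rewrite [peval q]E mulr_sumr; apply: eq_bigr => m' _ /=.
rewrite pevalZ pevalX rmorphM (pmonD _ (cp m pm)).2.
by rewrite -!mulrA; congr (_ * _); rewrite !mulrA C_comm.
Qed.

Lemma pmonU i e : pmon (U_(i) *+ e)%MM = X i ^+ e.
Proof.
have := mem_index_enum i; have := index_enum_uniq 'I_n; rewrite /pmon => Uw iw.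
case/path.splitPr: iw Uw => w1 w2; rewrite cat_uniq /= => /and4P[_ /norP[iw1 _] iw2 _].
have U1 w : i \notin w -> \prod_(j <- w) X j ^+ (U_(i) *+ e)%MM j = 1.
  move=> iw; apply: big1_seq => j /= jw; rewrite mulmnE mnm1E.
  by case: eqP jw iw => [<- -> //|_ _ _]; rewrite mul0n.
by rewrite big_cat big_cons /= !U1 // mulmnE mnm1E eqxx mul1n mul1r mulr1.
Qed.

Definition lattice_supported (L : 'I_n -> nat) p :=
  forall m, m \in msupp p -> forall i, (L i %| m i)%N.

Variable L : 'I_n -> nat.
Hypothesis XL_central : forall i, central (X i ^+ L i).

Lemma lattice_exp_central m : (forall i, (L i %| m i)%N) ->
  forall i, central (X i ^+ m i).
Proof. by move=> Lm i; rewrite -(divnK (Lm i)) mulnC exprM; apply: centralX. Qed.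

Lemma lattice_pmon_central m : (forall i, (L i %| m i)%N) -> central (pmon m).
Proof. by move=> Lm; apply: (pmonD 0%MM (lattice_exp_central Lm)).1. Qed.

Lemma lattice_supported_central p : lattice_supported L p ->
  forall m, m \in msupp p -> forall i, central (X i ^+ m i).
Proof. by move=> Lp m /Lp; apply: lattice_exp_central. Qed.

Lemma lattice_supportedD p q :
  lattice_supported L p -> lattice_supported L q -> lattice_supported L (p + q).
Proof. by move=> Lp Lq m /msuppD_le; rewrite mem_cat => /orP[/Lp|/Lq]. Qed.

Lemma lattice_supportedB p q :
  lattice_supported L p -> lattice_supported L q -> lattice_supported L (p - q).
Proof. by move=> Lp Lq m /msuppB_le; rewrite mem_cat => /orP[/Lp|/Lq]. Qed.

Lemma lattice_supportedM p q :
  lattice_supported L p -> lattice_supported L q -> lattice_supported L (p * q).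
Proof.
move=> Lp Lq m /msuppM_le/allpairsP[[a b] /= [/Lp La /Lq Lb ->]] i.
by rewrite mnmDE dvdn_add.
Qed.

Lemma lattice_supportedC c : lattice_supported L c%:MP.
Proof.
move=> m; rewrite msuppC; case: ifP => // _; rewrite inE => /eqP-> i.
by rewrite mnmE dvdn0.
Qed.

Lemma lattice_supportedX m : (forall i, (L i %| m i)%N) -> lattice_supported L 'X_[m].
Proof. by move=> Lm m'; rewrite msuppX inE => /eqP->. Qed.

(** As the [X i ^+ L i] are central, evaluations of lattice-supported polynomials are closed under
    products. This replaces the inductive description of the power subalgebra by a condition on
    exponents. *)
Lemma subring_gen_powersE z :
  subring_gen (fun x => (exists c, x = C c) \/ (exists i, x = X i ^+ L i)) z <->
  exists2 p, lattice_supported L p & z = peval p.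
Proof.
split=> [|[p Lp ->]].
  elim=> {z} [_ [[c ->]|[i ->]]||x y _ [p Lp ->] _ [q Lq ->]|x y _ [p Lp ->] _ [q Lq ->]].
  - by exists c%:MP; [exact: lattice_supportedC | rewrite pevalC].
  - exists 'X_[U_(i) *+ L i].
      apply: lattice_supportedX => j; rewrite mulmnE mnm1E.
      by case: eqP => [->|_]; rewrite ?mul1n ?mul0n ?dvdnn ?dvdn0.
    by rewrite pevalX pmonU.
  - by exists 1%:MP; [exact: lattice_supportedC | rewrite pevalC rmorph1].
  - by exists (p - q); [exact: lattice_supportedB | rewrite raddfB].
  - exists (p * q); first exact: lattice_supportedM.
    by rewrite peval_mul //; apply: lattice_supported_central.
set G := subring_gen _.
have G1 : G 1 by exact: subring_gen1.
have G0 : G 0 by rewrite -[0](subrr 1); apply: subring_genB.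
have GD x y : G x -> G y -> G (x + y).
  by move=> Gx Gy; rewrite -[y]opprK -[- y]sub0r; apply/subring_genB/subring_genB.
rewrite /peval big_seq; elim/big_ind: _ => // m /Lp Lm; apply: subring_genM.
  by apply: subring_gen_mem; left; exists p@_m.
rewrite /pmon; elim/big_ind: _ => [//|x y|i _]; first exact: subring_genM.
rewrite -(divnK (Lm i)) mulnC exprM; elim: (_ %/ _)%N => [//|e IHe].
by rewrite exprS; apply: subring_genM => //; apply: subring_gen_mem; right; exists i.
Qed.

End CentralPowers.

Lemma mcoeff_sum_msupp n (T : idomainType) (p : mpoly n T)
    (f : 'X_{1..n} -> T) (P : pred 'X_{1..n}) m0 :
  (forall m, m \notin msupp p -> f m = 0) ->
  (\sum_(m <- msupp p | P m) f m *: 'X_[m])@_m0 = if P m0 then f m0 else 0.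
Proof.
move=> f0; rewrite raddf_sum /= big_mkcond /=.
have other m : m != m0 -> (if P m then (f m *: 'X_[m])@_m0 else 0) = 0.
  by move=> mm0; rewrite mcoeffZ mcoeffX (negbTE mm0) mulr0 if_same.
have [pm0|pm0] := boolP (m0 \in msupp p).
  rewrite (bigD1_seq m0) ?msupp_uniq //= big1 ?addr0 => [|m /other//].
  by rewrite mcoeffZ mcoeffX eqxx mulr1.
rewrite big1_seq ?f0 ?if_same // => m /= pm; apply: other.
by apply: contraNneq pm0 => <-.
Qed.

Section FilteredCenter.
Variables (n : nat) (T : idomainType) (A : pzRingType) (F : filtration A).
Variables (C : {rmorphism T -> A}) (X : 'I_n -> A) (Q : 'I_n -> 'I_n -> T).
Hypothesis C_comm : forall c x, x * C c = C c * x.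
Hypothesis F_C : forall c, F 0 (C c).
Hypothesis F_X : forall i, F 1 (X i).
Hypothesis F_word : forall k x, F k x -> exists2 s : seq (T * seq 'I_n),
  (forall t, t \in s -> (size t.2 <= k)%N) & x = \sum_(t <- s) C t.1 * pword X t.2.
Hypothesis F_all : forall x, exists k, F k x.
Hypothesis Q_unit : forall i j, Q i j \is a GRing.unit.
Hypothesis F_swap : forall i j, F 1 (X j * X i - C (Q i j) * (X i * X j)).
Local Notation pmon := (pmon X).
Local Notation pword := (pword X).
Local Notation peval := (peval C X).
Implicit Types (i j : 'I_n) (c : T) (m : 'X_{1..n}) (w : seq 'I_n) (k l : nat).
Implicit Types (x y : A) (p : mpoly n T).

Let E := fil_prev F.
Let E0 : forall k, E k 0 := fil_prev0 F.
Let ED := @fil_prevD _ F.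
Let EMl := @fil_prevMl _ F.
Let EMr := @fil_prevMr _ F.

Let EC c k x : E k x -> E k (C c * x).
Proof. by move=> Ex; rewrite -[k]add0n; apply: EMl. Qed.

Lemma fil_prev_leq k l x : (k <= l)%N -> E k x -> E l x.
Proof.
case: k l => [|k] [|l] //= kl; last exact: fil_leq.
by move=> ->; apply: fil_0.
Qed.

Let E_sum (I : eqType) (r : seq I) (f : I -> A) k :
  (forall a, a \in r -> E k (f a)) -> E k (\sum_(a <- r) f a).
Proof.
move=> Ef; rewrite big_seq; elim/big_ind: _ => [||i /Ef//]; first exact: E0.
by move=> x y; apply: ED.
Qed.

(** Strong induction on the degree: straightening a word leaves an error in the preceding filtration
    step, which is [0] for the empty word. *)
Lemma fil_peval_bounded k x : F k x -> exists2 p,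
  (forall m, m \in msupp p -> (mdeg m <= k)%N) & x = peval p.
Proof.
have [K] := ubnP k; elim: K k x => // K IHK k x; rewrite ltnS => kK /F_word[s sk ->].
rewrite big_seq; elim/big_ind: _ => [|_ _ [p pk ->] [q qk ->]|[c w] /sk /= wk].
- by exists 0; [rewrite msupp0 | rewrite raddf0].
- exists (p + q); last by rewrite raddfD.
  by move=> m /msuppD_le; rewrite mem_cat => /orP[/pk|/qk].
have [u _] := pword_upto C_comm F_C F_X Q_unit E0 ED EMl EMr F_swap w.
set e := _ - _ => Ee.
have [q qk eE] : exists2 p, (forall m, m \in msupp p -> (mdeg m <= k)%N) & e = peval p.
  move: Ee; rewrite /E /fil_prev; case wE: (size w) => [|l].
    by move=> ->; exists 0; [rewrite msupp0 | rewrite raddf0].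
  have lk : (l < k)%N by rewrite -wE.
  move=> /IHK[|p pl ->]; first exact: leq_trans lk kK.
  by exists p => // m /pl /leq_trans; apply; apply: ltnW.
exists (c *: (u *: 'X_[word_mnm w] + q)).
  move=> m /msuppZ_le /msuppD_le; rewrite mem_cat => /orP[/msuppZ_le|/qk//].
  by rewrite msuppX inE => /eqP->; rewrite mdeg_word_mnm.
by rewrite pevalZ raddfD /= pevalZ pevalX -eE [_ + e]addrC subrK.
Qed.

Lemma peval_surj x : exists p, x = peval p.
Proof. by have [k /fil_peval_bounded[p _ ->]] := F_all x; exists p. Qed.

(** The product is the scalar that [pmon_mulX_upto] produces when [X i] crosses [pmon m]; these
    exponents form the monoid [M]. *)
Definition qcentral m := [forall i, \prod_j Q i j ^+ m j == 1].

Hypothesis peval_inj : forall p, peval p = 0 -> p = 0.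
Hypothesis qcentral_central : forall m, qcentral m -> central (pmon m).

(* The part of [p] outside the monoid [qcentral] is central too, and the commutator
   of its leading form with [X i] has no cancellation. *)
Lemma central_peval p :
  central (peval p) -> forall m, m \in msupp p -> qcentral m.
Proof.
move=> cp; pose p' : mpoly n T := \sum_(m <- msupp p | ~~ qcentral m) p@_m *: 'X_[m].
have p'E m : p'@_m = if ~~ qcentral m then p@_m else 0.
  by apply: mcoeff_sum_msupp => m'; apply: memN_msupp_eq0.
have {cp} cp' : central (peval p').
  have -> : p' = p - \sum_(m <- msupp p | qcentral m) p@_m *: 'X_[m].
    apply/eqP; rewrite eq_sym subr_eq; apply/eqP.
    by rewrite {1}[p]mpolyE (bigID qcentral) /= addrC.
  move=> y; rewrite /GRing.comm raddfB mulrBl mulrBr cp; congr (_ - _).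
  apply: central_sum => m; rewrite mcoeff_msupp mcoeff_sum_msupp; last first.
    by move=> m'; apply: memN_msupp_eq0.
  case: ifP => [Mm _|]; last by rewrite eqxx.
  by apply: centralM; [apply: central_cst | apply: qcentral_central].
have [p'0|p'_neq0] := eqVneq p' 0.
  move=> m; rewrite mcoeff_msupp; apply: contraR => Mm.
  by have := p'E m; rewrite Mm p'0 mcoeff0 => <-.
exfalso; pose m0 := mlead p'; pose k := mdeg m0.
have p'm0 : m0 \in msupp p' by apply: mlead_supp.
have p'k m : m \in msupp p' -> (mdeg m <= k)%N.
  by move=> /msize_mdeg_lt; rewrite -(mlead_deg p'_neq0) ltnS.
have /forallPn[i chi0] : ~~ qcentral m0.
  by move: p'm0; rewrite mcoeff_msupp p'E; case: (qcentral m0) => //; rewrite eqxx.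
pose chi m := \prod_j Q i j ^+ m j.
have /choice[u uP] m : exists v, v \is a GRing.unit /\
    E (mdeg m).+1 (X i * pmon m - C v * pmon (U_(i) + m)%MM).
  have [v v_unit Ev] := mulX_pmon_upto C_comm F_C F_X Q_unit E0 ED EMl EMr F_swap i m.
  by exists v.
(* To leading order [pmon m * X i - X i * pmon m] is [(chi m - 1) * u m] times the ordered monomial
   at [U_(i) + m]. *)
pose g m := p'@_m * ((chi m - 1) * u m).
pose D : mpoly n T := \sum_(m <- msupp p' | true) g m *: 'X_[m].
have DE m : D@_m = g m.
  rewrite mcoeff_sum_msupp // => m' /memN_msupp_eq0.
  by rewrite /g => ->; rewrite mul0r.
have peD : peval (D * 'X_i) = \sum_(m <- msupp p') C (g m) * pmon (U_(i) + m)%MM.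
  rewrite /D mulr_suml raddf_sum; apply: eq_bigr => m _ /=.
  by rewrite -scalerAl -mpolyXD addmC pevalZ pevalX.
(* The full commutator is zero, so its leading terms equal the straightening errors and drop into
   [F k]. *)
have /fil_peval_bounded[e ek peE] : F k (peval (D * 'X_i)).
  rewrite -[F k]/(E k.+1) peD.
  have z0 : peval p' * X i - X i * peval p' = 0 by rewrite cp' subrr.
  suff: E k.+1 (\sum_(m <- msupp p') C (g m) * pmon (U_(i) + m)%MM
      - (peval p' * X i - X i * peval p')) by rewrite z0 subr0.
  have -> : peval p' = \sum_(m <- msupp p') C p'@_m * pmon m by [].
  rewrite mulr_suml mulr_sumr -!sumrB.
  apply: E_sum => m /p'k mk; apply: (@fil_prev_leq (mdeg m).+1); first by rewrite ltnS.
  have -> : C (g m) * pmon (U_(i) + m)%MM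
      - (C p'@_m * pmon m * X i - X i * (C p'@_m * pmon m))
      = C p'@_m * (C (-1) * (pmon m * X i - C (chi m) * (X i * pmon m))
        + C (1 - chi m) * (X i * pmon m - C (u m) * pmon (U_(i) + m)%MM)).
    have -> : C (g m) = C p'@_m * ((C (chi m) - 1) * C (u m)).
      by rewrite /g !rmorphM rmorphB rmorph1.
    rewrite [X i * (C _ * _)]mulrA (C_comm _ (X i)) -!mulrA -!mulrBr.
    rewrite rmorphN rmorphB rmorph1.
    congr (_ * _); rewrite mulN1r !mulrBl !mul1r !mulrBr !opprB addrC [RHS]addrA.
    by rewrite [RHS](AC ((2*2)*2) ((1*6)*(3*2)*(5*4))) /= subrr add0r.
  refine (EC _ (ED (EC _ _) (EC _ _))); last by have [] := uP m.
  exact: (pmon_mulX_upto C_comm F_C F_X E0 ED EMl EMr F_swap i m).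
have De : D * 'X_i = e.
  by apply/eqP; rewrite -subr_eq0; apply/eqP/peval_inj; rewrite raddfB /= peE subrr.
(* The coefficient there is nonzero because [chi m0] differs from [1] and [u m0] is a unit, yet the
   degree [k.+1] exceeds the bound on [e]. *)
have : (U_(i) + m0)%MM \in msupp e.
  rewrite mcoeff_msupp -De mcoeffMX DE !mulf_neq0 ?subr_eq0 -?mcoeff_msupp //.
  by apply: contraTneq (uP m0).1 => ->; rewrite unitr0.
by move=> /ek; rewrite mdegD mdeg1 ltnn.
Qed.

Lemma filtered_centerP z :
  central z <-> exists2 p, (forall m, m \in msupp p -> qcentral m) & z = peval p.
Proof.
split=> [cz|[p Mp ->]].
  by have [p zE] := peval_surj z; exists p => //; apply: central_peval; rewrite -zE.
apply: central_sum => m /Mp Mm; apply: centralM; last exact: qcentral_central.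
exact: central_cst.
Qed.

End FilteredCenter.

(** * Monomial bases of the presented algebras *)

Section FreeAlgebra.
Variables (n : nat) (T : idomainType).
Implicit Types (f g : free_alg n T) (c : T) (u v w : seq 'I_n) (m : 'X_{1..n}).

Definition free_word w : free_alg n T := \prod_(i <- w) free_var T i.

Lemma free_word_cat u v : free_word (u ++ v) = free_word u * free_word v.
Proof. exact: big_cat. Qed.

Lemma free_word2 i j : free_var T i * free_var T j = free_word [:: i; j].
Proof. by rewrite /free_word !big_cons big_nil mulr1. Qed.

Lemma free_word_monom (w : {fmonom 'I_n}) : free_word w = << w >>.
Proof.
rewrite -[w in RHS](monalg.fmK w); elim: (w : seq _) => [|i s IHs].
  by rewrite /free_word big_nil -fmoneE.
rewrite /free_word big_cons -/(free_word s) IHs /free_var.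
rewrite -[LHS]/(<< _ >> * << _ >>) monalg.malgM_def fgmulUU mulr1 fmuE.
by rewrite [mmul _ _]fmmulE.
Qed.

Lemma free_algE f :
  f = \sum_(w <- monalg.msupp f) monalg.mcoeff w f *: free_word w.
Proof.
rewrite [LHS]monalg.monalgE; apply: eq_bigr => w _.
rewrite free_word_monom; apply/monalg.malgP => k.
by rewrite monalg.mcoeffZ !monalg.mcoeffU mulr_natr.
Qed.

Lemma free_mulr_alg f c : f * c%:A = c *: f.
Proof.
rewrite -[c%:A]monalg.mul_malgC mulr1 monalg.malgM_def fgmulgU monalg.malgZ_def.
by apply: eq_bigr => w _; rewrite mulm1 mulrC.
Qed.

Lemma free_scalerAr f c g : f * (c *: g) = c *: (f * g).
Proof. by rewrite -free_mulr_alg mulrA free_mulr_alg. Qed.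

Lemma free_coefZ c f (w : {fmonom 'I_n}) :
  monalg.mcoeff w (c *: f) = c * monalg.mcoeff w f.
Proof. exact: monalg.mcoeffZ. Qed.

Definition mnm_word m : seq 'I_n := flatten [seq nseq (m i) i | i <- index_enum 'I_n].

Lemma mnm_wordK m : word_mnm (mnm_word m) = m.
Proof.
rewrite [RHS]multinomUE_id /mnm_word; elim: (index_enum _) => [|i r IHr].
  by rewrite /word_mnm !big_nil.
transitivity (word_mnm (nseq (m i) i)
    + word_mnm (flatten [seq nseq (m j) j | j <- r]))%MM.
  by rewrite /word_mnm -big_cat.
rewrite IHr big_cons; congr (_ + _)%MM; rewrite /word_mnm.
elim: (m i) => [|e IHe] /=; first by rewrite big_nil mulm0n.
by rewrite big_cons IHe mulmS.
Qed.

Lemma pword_mnm_word (A : pzRingType) (X : 'I_n -> A) m :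
  pword X (mnm_word m) = pmon X m.
Proof.
rewrite /pmon /mnm_word; elim: (index_enum _) => [|i r IHr].
  by rewrite /pword !big_nil.
transitivity (pword X (nseq (m i) i) * pword X (flatten [seq nseq (m j) j | j <- r])).
  by rewrite /pword -big_cat.
rewrite IHr big_cons; congr (_ * _); rewrite /pword.
elim: (m i) => [|e IHe] /=; first by rewrite big_nil expr0.
by rewrite big_cons IHe exprS.
Qed.

End FreeAlgebra.

Lemma pword2 n (A : pzRingType) (X : 'I_n -> A) i j : pword X [:: i; j] = X i * X j.
Proof. by rewrite /pword !big_cons big_nil mulr1. Qed.

Section PresentedTheory.
Variables (n : nat) (T : idomainType) (S : free_alg n T -> Prop).
Local Notation X := (pvar S).
Local Notation C := (pcst S).
Implicit Types (i j : 'I_n) (c : T).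

Fact pcst_zmod_morphism : zmod_morphism C.
Proof. by move=> c e; rewrite /pcst scalerBl rmorphB. Qed.

HB.instance Definition _ := GRing.isZmodMorphism.Build T (presented S) C
  pcst_zmod_morphism.

Fact pcst_monoid_morphism : monoid_morphism C.
Proof.
split=> [|c e]; first by rewrite /pcst scale1r rmorph1.
by rewrite /pcst -rmorphM /= -scalerAl mul1r scalerA.
Qed.

HB.instance Definition _ := GRing.isMonoidMorphism.Build T (presented S) C
  pcst_monoid_morphism.

Lemma presP (x : presented S) : exists f, x = pres S f.
Proof. exact: quot_ringP. Qed.

Lemma pres_eq0 f : S f -> pres S f = 0.
Proof.
move=> Sf; rewrite -(rmorph0 (pres S)); apply/to_quot_eq; rewrite subr0.
by have := ideal_genD 1 1 Sf (ideal_gen0 S); rewrite mul1r mulr1 addr0.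
Qed.

Lemma presZ c f : pres S (c *: f) = C c * pres S f.
Proof. by rewrite /pcst -rmorphM /= -scalerAl mul1r. Qed.

Lemma presB f g : pres S (f - g) = pres S f - pres S g.
Proof. exact: rmorphB. Qed.

Lemma presBB f g h : pres S (f - g - h) = pres S f - pres S g - pres S h.
Proof. by rewrite !presB. Qed.

Lemma pcstC c x : x * C c = C c * x.
Proof. by have [f ->] := presP x; rewrite -presZ /pcst -rmorphM /= free_mulr_alg. Qed.

Lemma pres_word w : pres S (free_word T w) = pword X w.
Proof. exact: rmorph_prod. Qed.

Lemma presE f :
  pres S f = \sum_(w <- monalg.msupp f) C (monalg.mcoeff w f) * pword X w.
Proof.
rewrite {1}[f]free_algE rmorph_sum /=; apply: eq_bigr => w _.
by rewrite presZ pres_word.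
Qed.

Lemma pres_rel i j c h :
  pres S (free_var T j * free_var T i - c *: (free_var T i * free_var T j) - h)
  = X j * X i - C c * (X i * X j) - pres S h.
Proof. by rewrite !free_word2 presBB presZ !pres_word !pword2. Qed.

Lemma deg_fil_words k x : deg_fil (S := S) k x -> exists2 s : seq (T * seq 'I_n),
  (forall t, t \in s -> (size t.2 <= k)%N) & x = \sum_(t <- s) C t.1 * pword X t.2.
Proof.
move=> [f fk <-].
exists [seq (monalg.mcoeff w f, w : seq 'I_n) | w <- monalg.msupp f].
  by move=> _ /mapP[w /fk wk ->].
by rewrite big_map presE.
Qed.

Lemma deg_fil_all (x : presented S) : exists k, deg_fil k x.
Proof.
have [f ->] := presP x; exists (\max_(w <- monalg.msupp f) fdeg w)%N; exists f => // w wf.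
exact: leq_bigmax_seq.
Qed.

End PresentedTheory.

(** * Commutation relations shared by the two algebras *)

Section QuantumRelations.
Variables (n : nat) (T : idomainType) (q a : 'I_n -> 'I_n -> T).
Hypothesis q_unit : forall i j : 'I_n, (i < j)%N -> q i j \is a GRing.unit.
Implicit Types (i j : 'I_n).

Lemma qfull_unit i j : qfull q i j \is a GRing.unit.
Proof.
rewrite /qfull; case: ifP => [/q_unit//|_]; case: ifP => [/q_unit|_].
  by rewrite unitrV.
exact: unitr1.
Qed.

Lemma qfullV i j : qfull q i j = (qfull q j i)^-1.
Proof. by rewrite /qfull; case: ltngtP => // _; rewrite ?invrK ?invr1. Qed.

(** One form for both presentations: [b = 0] gives the skew polynomial ring and [b = a] the Weyl
    algebra. *)
Definition quantum_rel (A : pzRingType) (C : T -> A) (X : 'I_n -> A) b :=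
  forall i j, (i < j)%N -> X j * X i = C (q i j) * (X i * X j) + C (b i j).

Lemma skew_quantum_rel :
  quantum_rel (pcst (skew_relator q)) (pvar (skew_relator q)) (fun _ _ => 0).
Proof.
move=> i j ij; rewrite rmorph0 addr0.
have /(pres_eq0 (S := skew_relator q)) : skew_relator q
    (free_var T j * free_var T i - q i j *: (free_var T i * free_var T j)).
  by exists i, j.
by rewrite !free_word2 presB presZ !pres_word !pword2 => /subr0_eq.
Qed.

Lemma weyl_quantum_rel :
  quantum_rel (pcst (weyl_relator q a)) (pvar (weyl_relator q a)) a.
Proof.
move=> i j ij.
have /(pres_eq0 (S := weyl_relator q a)) : weyl_relator q a
    (free_var T j * free_var T i - q i j *: (free_var T i * free_var T j)
      - (a i j)%:A).
  by exists i, j.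
by rewrite pres_rel => /subr0_eq/eqP; rewrite subr_eq addrC => /eqP.
Qed.

Section QuantumSwap.
Variables (A : pzRingType) (C : {rmorphism T -> A}) (X : 'I_n -> A).
Variable b : 'I_n -> 'I_n -> T.
Hypothesis rel : quantum_rel C X b.

Lemma quantum_swap i j : exists c, X j * X i = C (qfull q i j) * (X i * X j) + C c.
Proof.
rewrite /qfull; case: ltngtP => [ij|ji|/val_inj->].
- by exists (b i j); rewrite (rel ij).
- exists (- ((q j i)^-1 * b j i)).
  rewrite (rel ji) mulrDr mulrA -!(rmorphM C) mulVr ?q_unit // rmorph1 mul1r.
  by rewrite rmorphN addrK.
- by exists 0; rewrite rmorph1 mul1r rmorph0 addr0.
Qed.

(** The error is a constant; [F 1] appears because it is the error space [fil_prev F 2] for products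
    of degree two. *)
Lemma fil_swap (F : filtration A) : (forall c, F 0 (C c)) ->
  forall i j, F 1 (X j * X i - C (qfull q i j) * (X i * X j)).
Proof.
move=> F_C i j; have [c ->] := quantum_swap i j.
by rewrite addrC addKr; apply: fil_S.
Qed.

End QuantumSwap.

Lemma skew_swap (A : pzRingType) (C : {rmorphism T -> A}) (X : 'I_n -> A) :
  quantum_rel C X (fun _ _ => 0) ->
  forall i j, X j * X i = C (qfull q i j) * (X i * X j).
Proof.
move=> rel i j; rewrite /qfull; case: ltngtP => [ij|ji|/val_inj->].
- by rewrite (rel _ _ ij) rmorph0 addr0.
- rewrite (rel _ _ ji) rmorph0 addr0 mulrA -(rmorphM C) mulVr ?q_unit //.
  by rewrite rmorph1 mul1r.
- by rewrite rmorph1 mul1r.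
Qed.

End QuantumRelations.

(** Reduces the vanishing of a linear map on two-sided multiples of a relator [s] to multiples by
    words. *)
Lemma additive_triple_eq0 (T : comRingType) (B : lalgType T) (V : lmodType T)
    (h : {additive B -> V}) (I : Type) (r1 r2 : seq I) (c1 c2 : I -> T)
    (F : I -> B) (s : B) :
  (forall c f, h (c *: f) = c *: h f) ->
  (forall f c g, f * (c *: g) = c *: (f * g) :> B) ->
  (forall u v, h (F u * s * F v) = 0) ->
  h ((\sum_(u <- r1) c1 u *: F u) * s * (\sum_(v <- r2) c2 v *: F v)) = 0.
Proof.
move=> hZ Ar h0; rewrite !mulr_suml raddf_sum big1 // => u _.
rewrite mulr_sumr raddf_sum big1 // => v _.
by rewrite Ar -!scalerAl !hZ h0 !scaler0.
Qed.

(** * Linear independence of the ordered monomials in the skew polynomial ring *)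

Section SkewNormalForm.
Variables (n : nat) (T : idomainType) (q : 'I_n -> 'I_n -> T).
Hypothesis q_unit : forall i j : 'I_n, (i < j)%N -> q i j \is a GRing.unit.
Implicit Types (i j : 'I_n) (u v w : seq 'I_n) (f : free_alg n T).

(* The scalar that appears when [w] is sorted by means of the relations
   [x_j x_i = q i j x_i x_j]. *)
Fixpoint sort_coef w : T :=
  if w is i :: w' then (\prod_(j <- w' | (j < i)%N) q j i) * sort_coef w' else 1.

Lemma sort_coef_unit w : sort_coef w \is a GRing.unit.
Proof.
elim: w => [|i w IHw] /=; first exact: unitr1.
rewrite unitrM IHw andbT; elim/big_ind: _ => [||j /q_unit//]; first exact: unitr1.
by move=> b c; rewrite unitrM => -> ->.
Qed.

(** Exchanging two adjacent letters affects only the inversion between these two. *)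
Lemma sort_coef_swap i j u v : (i < j)%N ->
  sort_coef (u ++ j :: i :: v) = q i j * sort_coef (u ++ i :: j :: v).
Proof.
move=> ij; elim: u => [|l u IHu] /=.
  rewrite !big_cons ij ltnNge (ltnW ij) /= -!mulrA; congr (_ * _).
  by rewrite mulrCA.
rewrite IHu mulrCA; congr (_ * (_ * _)); apply: perm_big.
by rewrite perm_cat2l; apply/permPl/(perm_catCA [:: j] [:: i] v).
Qed.

(** A linear, not multiplicative, map to commutative polynomials. It kills the ideal of relations
    and therefore separates the ordered monomials. *)
Definition skew_normal (f : free_alg n T) : mpoly n T :=
  monalg.mmap (mpolyC n (R := T))
    (fun w : {fmonom 'I_n} => sort_coef w *: 'X_[word_mnm w]) f.

Fact skew_normal_zmod_morphism : zmod_morphism skew_normal.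
Proof. exact: raddfB. Qed.

HB.instance Definition _ := GRing.isZmodMorphism.Build (free_alg n T) (mpoly n T)
  skew_normal skew_normal_zmod_morphism.

Lemma skew_normalZ c f : skew_normal (c *: f) = c *: skew_normal f.
Proof.
rewrite /skew_normal (monalg.mmapEw (monalg.msuppZ_le _ _)) /monalg.mmap scaler_sumr.
apply: eq_bigr => w _.
transitivity ((monalg.mcoeff w (c *: f))%:MP_[n] * (sort_coef w *: 'X_[word_mnm w])).
  by [].
by rewrite free_coefZ !mul_mpolyC -scalerA.
Qed.

Lemma skew_normal_word w :
  skew_normal (free_word T w) = sort_coef w *: 'X_[word_mnm w].
Proof.
have := free_word_monom T (monalg.FMonom w); rewrite /= => ->.
by rewrite /skew_normal monalg.mmapU mul_mpolyC scale1r.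
Qed.

Lemma skew_normal_relator f s g : skew_relator q s -> skew_normal (f * s * g) = 0.
Proof.
move=> [i [j [ij ->]]]; set s' := _ - _.
have word0 u v : skew_normal (free_word T u * s' * free_word T v) = 0.
  have -> : free_word T u * s' * free_word T v = free_word T (u ++ j :: i :: v)
      - q i j *: free_word T (u ++ i :: j :: v).
    rewrite /s' !free_word2 mulrBr mulrBl free_scalerAr -scalerAl.
    by rewrite -!free_word_cat -!catA.
  rewrite raddfB /= skew_normalZ !skew_normal_word sort_coef_swap // scalerA.
  rewrite (_ : word_mnm (u ++ j :: _) = word_mnm (u ++ i :: j :: v)) ?subrr //.
  apply: perm_big.
  by rewrite perm_cat2l; apply/permPl/(perm_catCA [:: j] [:: i] v).
rewrite [f]free_algE [g]free_algE.
apply: (@additive_triple_eq0 _ _ _ skew_normal) => //; first exact: skew_normalZ.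
exact: free_scalerAr.
Qed.

Lemma skew_normal_ideal f : pres (skew_relator q) f = 0 -> skew_normal f = 0.
Proof.
rewrite -(rmorph0 (pres (skew_relator q))) => /to_quot_eq; rewrite subr0.
elim=> [|g s h f' rel_s _ IHf]; first exact: raddf0.
by rewrite raddfD /= skew_normal_relator // IHf addr0.
Qed.

Lemma skew_peval_inj p :
  peval (pcst (skew_relator q)) (pvar (skew_relator q)) p = 0 -> p = 0.
Proof.
(* Lift [p] to ordered words in the free algebra; [skew_normal] gives back each coefficient of [p]
   up to a unit. *)
move=> p0; pose f : free_alg n T := \sum_(m <- msupp p) p@_m *: free_word T (mnm_word m).
have /skew_normal_ideal : pres (skew_relator q) f = 0.
  rewrite -p0 /f rmorph_sum /peval; apply: eq_bigr => m _ /=.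
  by rewrite presZ pres_word pword_mnm_word.
rewrite /f raddf_sum /= => f0; apply/mpolyP => m; rewrite mcoeff0.
have := congr1 (mcoeff m) f0; rewrite mcoeff0.
rewrite (eq_bigr (fun m => (p@_m * sort_coef (mnm_word m)) *: 'X_[m])); last first.
  by move=> m' _; rewrite skew_normalZ skew_normal_word mnm_wordK scalerA.
rewrite (@mcoeff_sum_msupp _ _ _ _ predT) => [/= /eqP|m' /memN_msupp_eq0->]; last first.
  by rewrite mul0r.
rewrite mulf_eq0 => /orP[/eqP//|/eqP s0].
by have := sort_coef_unit (mnm_word m); rewrite s0 unitr0.
Qed.

End SkewNormalForm.

(** * Transfer of linear independence through the associated graded ring *)

Section GradedClasses.
Variables (A : pzRingType) (F : filtration A).
Implicit Types (k l : nat) (x y : A) (g h : gr_ring F).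

(** The relational form of [gr_class] does not depend on a chosen proof of [F k x]. *)
Definition is_gr_class k x g := exists Fx : F k x, g = gr_class Fx.

Lemma is_gr_class1 : is_gr_class 0 1 1.
Proof.
exists (fil_1 F); rewrite /gr_class -(rmorph1 (to_quot (gr_ideal F))).
by congr (to_quot _ _); apply: val_inj.
Qed.

Lemma is_gr_classD k x y g h :
  is_gr_class k x g -> is_gr_class k y h -> is_gr_class k (x + y) (g + h).
Proof.
move=> [Fx ->] [Fy ->]; exists (fil_add Fx Fy); rewrite /gr_class -rmorphD.
congr (to_quot _ _); apply: val_inj; apply/funext => m /=.
rewrite -[LHS]/(seqr_single k x m + seqr_single k y m) /seqr_single.
by case: eqP => // _; rewrite addr0.
Qed.

Lemma is_gr_class0 k : is_gr_class k 0 0.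
Proof.
exists (fil_0 F k); rewrite /gr_class -(rmorph0 (to_quot (gr_ideal F))).
congr (to_quot _ _); apply: val_inj; apply/funext => m /=.
by rewrite /seqr_single if_same.
Qed.

Lemma is_gr_classM k l x y g h :
  is_gr_class k x g -> is_gr_class l y h -> is_gr_class (k + l)%N (x * y) (g * h).
Proof.
move=> [Fx ->] [Fy ->]; exists (fil_M Fx Fy); rewrite /gr_class -rmorphM.
congr (to_quot _ _); apply: val_inj; apply/funext => m /=.
rewrite -[LHS]/(\sum_(i < m.+1) seqr_single k x i * seqr_single l y (m - i)%N).
rewrite /seqr_single; case: eqP => [->|mkl].
  rewrite (bigD1 (Ordinal (leq_addr l k : (k < (k + l).+1)%N))) //= eqxx addKn eqxx.
  rewrite big1 ?addr0 // => i; rewrite -val_eqE /= => /negbTE->.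
  by rewrite mul0r.
rewrite big1 // => i _; case: eqP => [ik|_]; last by rewrite mul0r.
case: eqP => [il|_]; last by rewrite mulr0.
by case: mkl; rewrite -ik -il subnKC // -ltnS.
Qed.

Lemma is_gr_class_fil_prev k x g : is_gr_class k x g -> fil_prev F k x -> g = 0.
Proof.
move=> [Fx ->] Fx'; rewrite -(rmorph0 (to_quot (gr_ideal F))); apply/to_quot_eq.
rewrite subr0 => m; rewrite /= /seqr_single.
by case: eqP => [->//|_]; apply: fil_prev0.
Qed.

End GradedClasses.

Section GradedTransfer.
Variables (n : nat) (T : idomainType) (A B : pzRingType) (F : filtration B).
Variables (psi : {rmorphism A -> gr_ring F}).
Variables (CA : {rmorphism T -> A}) (XA : 'I_n -> A).
Variables (CB : {rmorphism T -> B}) (XB : 'I_n -> B).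
Hypothesis psi_inj : injective psi.
Hypothesis psi_cst : forall c, is_gr_class 0 (CB c) (psi (CA c)).
Hypothesis psi_var : forall i, is_gr_class 1 (XB i) (psi (XA i)).

Lemma gr_class_pmon m : is_gr_class (mdeg m) (pmon XB m) (psi (pmon XA m)).
Proof.
have clXn i e : is_gr_class e (XB i ^+ e) (psi (XA i ^+ e)).
  elim: e => [|e IHe]; first by rewrite !expr0 rmorph1; apply: is_gr_class1.
  by rewrite !exprS rmorphM -add1n; apply: is_gr_classM.
rewrite mdegE /pmon.
elim/big_rec3: _ => [|i k x y _ cl]; first by rewrite rmorph1; apply: is_gr_class1.
by rewrite rmorphM; apply: is_gr_classM.
Qed.

Lemma gr_class_peval (p : mpoly n T) k : (forall m, m \in msupp p -> mdeg m = k) ->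
  is_gr_class k (peval CB XB p) (psi (peval CA XA p)).
Proof.
move=> pk; rewrite /peval rmorph_sum big_seq [X in is_gr_class _ _ X]big_seq.
elim/big_rec2: _ => [|m x y /pk mk cl]; first exact: is_gr_class0.
apply: is_gr_classD => //; rewrite -mk rmorphM -[mdeg m]add0n.
exact/is_gr_classM/gr_class_pmon.
Qed.

(** In a relation [p] the top homogeneous part [pt] equals a combination of lower monomials, so its
    class in the graded ring is zero. Injectivity of [psi] carries the relation [pt] back to [A]. *)
Lemma peval_inj_transfer :
  (forall p, peval CA XA p = 0 -> p = 0) -> forall p, peval CB XB p = 0 -> p = 0.
Proof.
move=> A_inj p p0; apply/eqP; apply: contraT => p_neq0.
pose k := mdeg (mlead p).
have pk m : m \in msupp p -> (mdeg m <= k)%N.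
  by move=> /msize_mdeg_lt; rewrite -(mlead_deg p_neq0) ltnS.
pose pt : mpoly n T := \sum_(m <- msupp p | mdeg m == k) p@_m *: 'X_[m].
have ptE m : pt@_m = if mdeg m == k then p@_m else 0.
  rewrite (@mcoeff_sum_msupp _ _ _ _ (fun m => mdeg m == k)) // => m'.
  exact: memN_msupp_eq0.
have /gr_class_peval pt_cl : forall m, m \in msupp pt -> mdeg m = k.
  by move=> m; rewrite mcoeff_msupp ptE; case: ifP => [/eqP//|_]; rewrite eqxx.
have F_C c : F 0 (CB c) by have [] := psi_cst c.
have F_X i : F 1 (XB i) by have [] := psi_var i.
have /(is_gr_class_fil_prev pt_cl) : fil_prev F k (peval CB XB pt).
  have -> : peval CB XB pt = peval CB XB (pt - p) by rewrite raddfB /= p0 subr0.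
  have lt_k m : m \in msupp (pt - p) -> (mdeg m < k)%N.
    rewrite mcoeff_msupp mcoeffB ptE ltn_neqAle.
    case: (mdeg m =P k) => [_|_]; first by rewrite subrr eqxx.
    by rewrite sub0r oppr_eq0 -mcoeff_msupp => /pk.
  (* In degree [0] the preceding filtration step is [0], and [pt - p] has no monomials at all. *)
  move: lt_k; rewrite /fil_prev; generalize k => -[|k'] lt_k.
    suff -> : pt - p = 0 by rewrite raddf0.
    apply/mpolyP => m; rewrite mcoeff0; apply: memN_msupp_eq0.
    by apply/negP => /lt_k.
  exact: (fil_peval F_C F_X).
rewrite -(rmorph0 psi) => /psi_inj/A_inj pt0.
have := ptE (mlead p); rewrite pt0 mcoeff0 eqxx => /esym/eqP.
by rewrite mleadc_eq0 (negbTE p_neq0).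
Qed.

End GradedTransfer.

Lemma weyl_peval_inj n (T : idomainType) (q a : 'I_n -> 'I_n -> T) :
  (forall i j : 'I_n, (i < j)%N -> q i j \is a GRing.unit) ->
  gr_naturally_skew q a ->
  forall p, peval (pcst (weyl_relator q a)) (pvar (weyl_relator q a)) p = 0 -> p = 0.
Proof.
move=> q_unit [psi [psi_bij psiC psiX]].
apply: (@peval_inj_transfer n T (presented (skew_relator q)) _
  (deg_filtration (weyl_relator q a)) psi (pcst (skew_relator q)) (pvar (skew_relator q))).
- exact: bij_inj.
- by move=> c; rewrite psiC; exists (deg_fil_cst _ c).
- by move=> i; rewrite psiX; exists (deg_fil_var _ i).
- exact: skew_peval_inj.
Qed.

(** * Polynomial centres of skew polynomial rings *)

(** Uniqueness of the [X]-adic order and of the lowest coefficient. *)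
Lemma coefXnM_eq (R : idomainType) (a b : {poly R}) k l :
  'X^k * a = 'X^l * b -> a`_0 != 0 -> b`_0 != 0 -> k = l /\ a`_0 = b`_0.
Proof.
move=> ab a0 b0; have abk := congr1 (coefp k) ab; have abl := congr1 (coefp l) ab.
move: abk abl; rewrite /= !coefXnM !ltnn !subnn.
case: (ltngtP k l) => [_ ak|_ _ bl|-> _].
- by rewrite ak eqxx in a0.
- by rewrite -bl eqxx in b0.
by rewrite subnn.
Qed.

Lemma factor_polyX (R : idomainType) (a : {poly R}) : a`_0 = 0 ->
  exists2 b, a = 'X * b & b`_0 = a`_1.
Proof.
move=> a0; have /factor_theorem[b ab] : root a 0 by rewrite /root horner_coef0 a0.
rewrite polyC0 subr0 in ab.
by exists b; rewrite ab ?coefMX // mulrC.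
Qed.

Section SkewAlgebra.
Variables (n : nat) (T : idomainType) (A : pzRingType).
Variables (C : {rmorphism T -> A}) (X : 'I_n -> A) (Q : 'I_n -> 'I_n -> T).
Hypothesis C_comm : forall c x, x * C c = C c * x.
Hypothesis Q_unit : forall i j, Q i j \is a GRing.unit.
Hypothesis X_swap : forall i j, X j * X i = C (Q i j) * (X i * X j).
Hypothesis peval_inj : forall p, peval C X p = 0 -> p = 0.
Hypothesis peval_surj : forall x, exists p, x = peval C X p.
Local Notation pmon := (pmon X).
Local Notation peval := (peval C X).
Local Notation qcentral := (qcentral Q).
Implicit Types (i j : 'I_n) (c : T) (m : 'X_{1..n}) (p q : mpoly n T) (x y z : A).

(** The skew relations are exact, so straightening is applied with error [0] and no control of
    degrees. *)
Definition full_filtration : filtration A :=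
  @Filtration A (fun _ _ => True) (fun _ => I) (fun _ _ _ _ _ => I) (fun _ _ _ => I)
    I (fun _ _ _ _ _ _ => I).

Let E : nat -> A -> Prop := fun _ x => x = 0.
Let E0 k : E k 0. Proof. by []. Qed.
Let ED k x y : E k x -> E k y -> E k (x + y).
Proof. by move=> -> ->; rewrite /E addr0. Qed.
Let EMl l k x y : full_filtration l x -> E k y -> E (l + k)%N (x * y).
Proof. by move=> _ ->; rewrite /E mulr0. Qed.
Let EMr l k x y : E l x -> full_filtration k y -> E (l + k)%N (x * y).
Proof. by move=> -> _; rewrite /E mul0r. Qed.
Let E_swap i j : E 2 (X j * X i - C (Q i j) * (X i * X j)).
Proof. by rewrite /E X_swap subrr. Qed.

Lemma skew_pmon_central m : qcentral m -> central (pmon m).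
Proof.
move=> /forallP Mm; apply: (central_of_vars C_comm) => // i.
have /eqP := @pmon_mulX_upto _ _ _ full_filtration _ _ C_comm (fun=> I) (fun=> I) _ _
  E0 ED EMl EMr E_swap i m.
by rewrite subr_eq0 (eqP (Mm i)) rmorph1 mul1r => /eqP ->.
Qed.

Lemma skew_pmonM m m' : exists2 u, u \is a GRing.unit &
  pmon m * pmon m' = C u * pmon (m + m')%MM.
Proof.
have [u u_unit] := @pword_upto _ _ _ full_filtration _ _ C_comm (fun=> I) (fun=> I)
  _ _ Q_unit E0 ED EMl EMr E_swap (mnm_word m ++ mnm_word m').
move=> /eqP; rewrite subr_eq0 => /eqP uE; exists u => //.
move: uE; rewrite /pword big_cat -![\big[_/_]_(i <- mnm_word _) _]/(pword _ _) /=.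
rewrite !pword_mnm_word => ->; congr (_ * pmon _).
by rewrite /word_mnm big_cat -![\big[_/_]_(i <- mnm_word _) _]/(word_mnm _) /= !mnm_wordK.
Qed.

Lemma skew_pmonX m e : exists2 u, u \is a GRing.unit &
  pmon m ^+ e = C u * pmon (m *+ e)%MM.
Proof.
elim: e => [|e [u u_unit IHe]].
  by exists 1; rewrite ?unitr1 // rmorph1 mul1r mulm0n pmon0.
have [v v_unit vE] := skew_pmonM m (m *+ e)%MM.
exists (u * v); first by rewrite unitrM u_unit.
by rewrite exprS IHe mulrA C_comm -mulrA vE mulmS rmorphM mulrA.
Qed.

Lemma skew_peval_mul p q : exists2 r, peval p * peval q = peval r &
  forall m, m \in msupp r -> exists m1 m2,
    [/\ m1 \in msupp p, m2 \in msupp q & m = (m1 + m2)%MM].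
Proof.
pose P x := exists2 r, x = peval r & forall m, m \in msupp r -> exists m1 m2,
    [/\ m1 \in msupp p, m2 \in msupp q & m = (m1 + m2)%MM].
have P0 : P 0 by exists 0; [rewrite raddf0 | rewrite msupp0].
have PD x y : P x -> P y -> P (x + y).
  move=> [r -> rP] [r' -> rP']; exists (r + r'); first by rewrite raddfD.
  by move=> m /msuppD_le; rewrite mem_cat => /orP[/rP|/rP'].
suff [r -> rP] : P (peval p * peval q) by exists r.
have pvE s : peval s = \sum_(m <- msupp s) C s@_m * pmon m by [].
rewrite [peval p]pvE mulr_suml.
rewrite big_seq; elim/big_ind: _ => // m pm.
rewrite [peval q]pvE mulr_sumr.
rewrite big_seq; elim/big_ind: _ => // m' qm'.
have [u _ uE] := skew_pmonM m m'.
exists ((p@_m * q@_m' * u) *: 'X_[m + m']).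
  rewrite pevalZ pevalX !rmorphM -!mulrA -uE; congr (_ * _).
  by rewrite mulrA C_comm mulrA.
by move=> m0 /msuppZ_le; rewrite msuppX inE => /eqP->; exists m, m'.
Qed.

Lemma peval_eq p q : peval p = peval q -> p = q.
Proof. by move=> pq; apply/subr0_eq/peval_inj; rewrite raddfB /= pq subrr. Qed.

Definition qatom m := m != 0%MM /\
  forall m1 m2, qcentral m1 -> qcentral m2 -> (m1 + m2)%MM = m -> m1 = 0%MM \/ m2 = 0%MM.

(* Modulo products of two positive-degree central elements, the coefficient at
   [0] is an augmentation and the coefficient at an atom is a derivation. *)
Lemma skew_mul_coef p q r :
  (forall m, m \in msupp p -> qcentral m) -> (forall m, m \in msupp q -> qcentral m) ->
  peval p * peval q = peval r ->
  r@_0%MM = p@_0%MM * q@_0%MM /\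
  forall m, qatom m -> r@_m = p@_0%MM * q@_m + p@_m * q@_0%MM.
Proof.
move=> Mp Mq pqr; pose p1 := p - (p@_0%MM)%:MP; pose q1 := q - (q@_0%MM)%:MP.
have sub_supp s : forall m, m \in msupp (s - (s@_0%MM)%:MP) -> m != 0%MM /\ m \in msupp s.
  move=> m; rewrite !mcoeff_msupp mcoeffB mcoeffC.
  have [->|m0] := eqVneq m 0%MM; first by rewrite mulr1 subrr eqxx.
  by rewrite mulr0 subr0.
have [s s_eq sP] := skew_peval_mul p1 q1.
(* This is [p q = p_0 q + p_1 q_0 + p_1 q_1] after splitting off constant terms, with [s] for
   [p_1 q_1]. The support of [s] consists of sums of two nonzero elements of the monoid and misses
   [0] and all atoms. *)
have rE : r = p@_0%MM *: q + q@_0%MM *: p1 + s.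
  apply: peval_eq; rewrite -pqr 2!raddfD /= !pevalZ -s_eq.
  have pE : peval p = C p@_0%MM + peval p1 by rewrite raddfB /= pevalC addrC subrK.
  have qE : peval q = C q@_0%MM + peval q1 by rewrite raddfB /= pevalC addrC subrK.
  rewrite pE mulrDl -addrA; congr (_ + _).
  by rewrite [in LHS]qE mulrDr C_comm.
have s0 : s@_0%MM = 0.
  apply: memN_msupp_eq0; apply/negP => /sP[m1 [m2 [/sub_supp[m1_neq0 _] _]]].
  by move=> /esym/eqP; rewrite mnmD_eq0 (negbTE m1_neq0).
split=> [|m [m0 m_atom]].
  by rewrite rE !mcoeffD !mcoeffZ s0 mcoeffB mcoeffC eqxx mulr1 subrr mulr0 !addr0.
have sm : s@_m = 0.
  apply: memN_msupp_eq0; apply/negP => /sP[m1 [m2 [/sub_supp[m1_neq0 p1m1]]]].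
  move=> /sub_supp[m2_neq0 q1m2] mE.
  have [||/eqP|/eqP] := m_atom m1 m2 _ _ (esym mE); first exact: Mp; first exact: Mq.
    by rewrite (negbTE m1_neq0).
  by rewrite (negbTE m2_neq0).
rewrite rE !mcoeffD !mcoeffZ sm addr0 mcoeffB mcoeffC (negbTE m0) mulr0 subr0.
by rewrite [q@_0%MM * _]mulrC.
Qed.

Hypothesis centerP : forall z, central z <->
  exists2 p, (forall m, m \in msupp p -> qcentral m) & z = peval p.

Variable L : 'I_n -> nat.
Hypothesis L_gt0 : forall i, (0 < L i)%N.
Hypothesis qcentralU : forall i e, qcentral (U_(i) *+ e)%MM = (L i %| e)%N.

Definition qlattice m := [forall i, L i %| m i]%N.

Let e i : 'X_{1..n} := (U_(i) *+ L i)%MM.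

(** Summands of [e i] are multiples of [U_(i)], and by [qcentralU] a nonzero one in the monoid
    already has exponent at least [L i]. *)
Lemma qatomU i : qatom (e i).
Proof.
have eii : e i i = L i by rewrite mulmnE mnm1E eqxx mul1n.
split.
  apply/eqP => /(congr1 (fun m : 'X_{1..n} => m i)); rewrite eii mnmE => L0.
  by have := L_gt0 i; rewrite L0.
move=> m1 m2 M1 M2 m12.
have mE (m m' : 'X_{1..n}) : (m + m')%MM = e i -> m = (U_(i) *+ m i)%MM.
  move=> mm'; apply/mnmP => j; rewrite mulmnE mnm1E.
  have [<-|ij] := eqVneq i j; first by rewrite mul1n.
  have := congr1 (fun m : 'X_{1..n} => m j) mm'.
  rewrite mnmDE mulmnE mnm1E (negbTE ij) !mul0n => /eqP.
  by rewrite addn_eq0 => /andP[/eqP].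
have m1E := mE _ _ m12.
have m2E : m2 = (U_(i) *+ m2 i)%MM by apply: (mE m2 m1); rewrite addmC.
move: M1 M2; rewrite m1E m2E !qcentralU => /dvdn_leq L1 /dvdn_leq L2.
have := congr1 (fun m : 'X_{1..n} => m i) m12; rewrite mnmDE eii.
have [->|m1_gt0] := posnP (m1 i); first by left; rewrite mulm0n.
have [->|m2_gt0] := posnP (m2 i); first by right; rewrite mulm0n.
move=> mL; have := leq_add (L1 m1_gt0) (L2 m2_gt0).
by rewrite mL -[X in (_ <= X)%N]addn0 leq_add2l leqNgt L_gt0.
Qed.

Lemma qatomU_inj i j : e i = e j -> i = j.
Proof.
move=> /(congr1 (fun m : 'X_{1..n} => m i)); rewrite !mulmnE !mnm1E eqxx mul1n.
by case: eqP => // _ L0; have := L_gt0 i; rewrite L0.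
Qed.

Lemma polynomial_center_lattice r (f : {rmorphism mpoly r T -> A}) :
  injective f -> (forall c, f (mpolyC r c) = C c) ->
  (forall z, central z <-> exists h : mpoly r T, f h = z) ->
  forall m, qcentral m -> qlattice m.
Proof.
move=> f_inj fC f_center m Mm; apply: contraT => Lm.
have {m Mm Lm} [al Mal [Lal al_min]] : exists2 al, qcentral al & ~~ qlattice al /\
    forall m, qcentral m -> (mdeg m < mdeg al)%N -> qlattice m.
  have [K] := ubnP (mdeg m); elim: K m Mm Lm => // K IHK m Mm Lm mK.
  have [[m' [Mm' m'm Lm']]|no] := pselect (exists m',
    [/\ qcentral m', (mdeg m' < mdeg m)%N & ~~ qlattice m']).
    by apply: (IHK m') => //; apply: leq_trans m'm _.
  exists m => //; split=> // m' Mm' m'm; apply: contraT => Lm'.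
  by case: no; exists m'.
have al_neq0 : al != 0%MM.
  by apply: contraNneq Lal => ->; apply/forallP => i; rewrite mnmE dvdn0.
(* Two nonzero summands would have smaller degree, hence lie in the lattice together with their
   sum. *)
have al_atom : qatom al.
  split=> // m1 m2 M1 M2 m12; have [->|m1_neq0] := eqVneq m1 0%MM; first by left.
  have [->|m2_neq0] := eqVneq m2 0%MM; first by right.
  case/negP: Lal; have degm : (mdeg m1 + mdeg m2 = mdeg al)%N by rewrite -mdegD m12.
  have L1 : qlattice m1.
    by apply: al_min; rewrite // -degm -[X in (X < _)%N]addn0 ltn_add2l lt0n mdeg_eq0.
  have L2 : qlattice m2.
    by apply: al_min; rewrite // -degm -[X in (X < _)%N]add0n ltn_add2r lt0n mdeg_eq0.
  apply/forallP => i; rewrite -m12 mnmDE dvdn_add //; first exact: (forallP L1).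
  exact: (forallP L2).
have ale i : (e i == al) = false.
  apply/negbTE; apply: contraNneq Lal => <-; apply/forallP => j.
  by rewrite mulmnE mnm1E; case: eqP => [->|_]; rewrite ?mul1n ?mul0n ?dvdn0.
(* [N h] collects the coordinates of [f h] in the ordered monomials. *)
have /choice[N NE] (h : mpoly r T) : exists q, f h = peval q by apply: peval_surj.
have NM h : forall m, m \in msupp (N h) -> qcentral m.
  have /centerP[q Mq] : central (f h) by apply/f_center; exists h.
  by rewrite NE => /peval_eq ->.
have ND h h' : N (h + h') = N h + N h'.
  by apply: peval_eq; rewrite raddfD /= -!NE rmorphD.
have NMul h h' : (N (h * h'))@_0%MM = (N h)@_0%MM * (N h')@_0%MM /\
    forall m, qatom m ->
      (N (h * h'))@_m = (N h)@_0%MM * (N h')@_m + (N h)@_m * (N h')@_0%MM.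
  by apply: skew_mul_coef; [exact: NM | exact: NM | rewrite -!NE rmorphM].
have NC c : N (mpolyC r c) = c%:MP by apply: peval_eq; rewrite -NE fC pevalC.
pose lam h m := (N h)@_m.
(* The coefficient of [t] prescribed on a variable: [s] times the derivation at [al], plus the
   derivations at all [e i]. Since [mpoly r T] is free on its variables, the prescription extends to
   a ring morphism. *)
pose v (j : 'I_r) : {poly T} := lam 'X_j al *: 'X + (\sum_i lam 'X_j (e i))%:P.
(* The outer variable of [{poly {poly T}}] is [t], the inner one is [s]. *)
pose g := mmap (polyC \o polyC) (fun j : 'I_r => (lam 'X_j 0%MM)%:P%:P + 'X * (v j)%:P).
(* Modulo [t^2] both sides are an augmentation plus [t] times a derivation along it, so agreement on
   the generators gives agreement everywhere. This is where polynomiality of the centre enters. *)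
pose St h := (g h)`_0 = (lam h 0%MM)%:P /\
  (g h)`_1 = lam h al *: 'X + (\sum_i lam h (e i))%:P.
have StP h : St h.
  have StC c : St (mpolyC r c).
    rewrite /St /lam NC /g mmapC /= !coefC /= !mcoeffC eqxx (negbTE al_neq0) mulr1 mulr0.
    split=> //; rewrite scale0r add0r big1 ?polyC0 // => i _.
    by have [/negbTE e0 _] := qatomU i; rewrite mcoeffC e0 mulr0.
  have StD h1 h2 : St h1 -> St h2 -> St (h1 + h2).
    move=> [a0 a1] [b0 b1]; rewrite /St /g !mmapD !coefD a0 a1 b0 b1 /lam !ND !mcoeffD.
    split; first by rewrite polyCD.
    rewrite scalerDl addrACA -polyCD -big_split /=; congr (_ + (_)%:P).
    by apply: eq_bigr => i _; rewrite mcoeffD.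
  have StM h1 h2 : St h1 -> St h2 -> St (h1 * h2).
    move=> [a0 a1] [b0 b1]; have [M0 M1] := NMul h1 h2.
    rewrite /St /g !rmorphM /= !coefM !big_ord_recr !big_ord0 /= !add0r.
    rewrite a0 a1 b0 b1 /lam M0 (M1 _ al_atom).
    split; first by rewrite polyCM.
    have -> : \sum_i (N (h1 * h2))@_(e i) = (N h1)@_0%MM * (\sum_i (N h2)@_(e i))
        + (\sum_i (N h1)@_(e i)) * (N h2)@_0%MM.
      rewrite mulr_sumr mulr_suml -big_split; apply: eq_bigr => i _ /=.
      exact/M1/qatomU.
    by rewrite -!mul_polyC !(polyCD, polyCM); ring.
  have StX (j : 'I_r) : St 'X_j.
    by rewrite /St /g mmapX mmap1U !coefD !coefC !coefXM !coefC /= addr0 add0r.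
  have St1 : St 1 by rewrite -mpolyC1.
  have StXm (m : 'X_{1..r}) : St 'X_[m].
    rewrite mpolyXE_id; elim/big_ind: _ => // j _; elim: (m j) => // k IHk.
    by rewrite exprS; apply: StM.
  rewrite [h]mpolyE; elim/big_ind: _ => [|//|m _]; first by rewrite -mpolyC0.
  by rewrite -mul_mpolyC; apply: StM.
have lift m : qcentral m -> exists h, N h = 'X_[m].
  move=> Mm; have /f_center[h fh] := skew_pmon_central Mm.
  by exists h; apply: peval_eq; rewrite -NE fh pevalX.
have [pa paE] := lift al Mal.
have /choice[pe peE] i : exists h, N h = 'X_[e i].
  by apply: lift; rewrite qcentralU.
have [a gaE a0] : exists2 a, g pa = 'X * a & a`_0 = 'X.
  have [g0 g1] := StP pa; have [|a gaE aE] := @factor_polyX _ (g pa).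
    by rewrite g0 /lam paE mcoeffX (negbTE al_neq0).
  exists a => //; rewrite aE g1 /lam paE mcoeffX eqxx scale1r.
  rewrite big1 ?polyC0 ?addr0 // => i _.
  by rewrite mcoeffX eq_sym ale.
have /choice[b bP] i : exists b, g (pe i) = 'X * b /\ b`_0 = 1.
  have [g0 g1] := StP (pe i); have [|b gbE bE] := @factor_polyX _ (g (pe i)).
    by rewrite g0 /lam peE mcoeffX; have [/negbTE-> _] := qatomU i.
  exists b; split=> //; rewrite bE g1 /lam peE mcoeffX ale scale0r add0r.
  rewrite (bigD1 i) //= mcoeffX eqxx big1 ?addr0 // => j ji.
  by rewrite mcoeffX; case: eqP => // /qatomU_inj ij; rewrite ij eqxx in ji.
(* [K] is a common multiple of the [L i], so the [K]-th power of [x^al] is a unit times a product of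
   powers of the [x_i^(L_i)]. *)
pose K := (\prod_i L i)%N; have K_gt0 : (0 < K)%N by rewrite prodn_gt0.
have LK i : (L i %| K)%N by rewrite /K (bigD1 i) //= dvdn_mulr.
pose k i := (al i * K %/ L i)%N.
have [u u_unit uE] := skew_pmonX al K.
have rel : pa ^+ K = mpolyC r u * \prod_i pe i ^+ k i.
  apply: f_inj; rewrite rmorphM fC rmorph_prod rmorphXn NE paE pevalX uE.
  congr (_ * _); apply: eq_bigr => i _.
  rewrite [RHS]rmorphXn NE peE pevalX pmonU -exprM mulmnE; congr (_ ^+ _).
  by rewrite [(L i * _)%N]mulnC divnK // dvdn_mull.
have u_neq0 : u != 0 by apply: contraTneq u_unit => ->; rewrite unitr0.
have : 'X^K * a ^+ K = 'X^(\sum_i k i) * (u%:P%:P * \prod_i b i ^+ k i).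
  have gX h l : g (h ^+ l) = g h ^+ l by rewrite /g rmorphXn.
  have gM h h' : g (h * h') = g h * g h' by rewrite /g rmorphM.
  have gP (h : 'I_n -> mpoly r T) : g (\prod_i h i) = \prod_i g (h i).
    by rewrite /g rmorph_prod.
  have gC c : g (mpolyC r c) = c%:P%:P by rewrite /g mmapC.
  have := congr1 g rel; rewrite gX gaE exprMn gM gP gC => ->.
  rewrite mulrCA; congr (_ * _); rewrite -prodrXr -big_split.
  by apply: eq_bigr => i _ /=; rewrite gX (bP i).1 exprMn.
have coef0X (c : {poly {poly T}}) l : (c ^+ l)`_0 = c`_0 ^+ l.
  by rewrite -!horner_coef0 horner_exp.
have b0 : (u%:P%:P * \prod_i b i ^+ k i)`_0 = u%:P.
  rewrite -horner_coef0 hornerM hornerC horner_prod big1 ?mulr1 // => i _.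
  by rewrite horner_exp horner_coef0 (bP i).2 expr1n.
(* The lowest coefficients in [t] are [s^K] and the constant [u], whose degrees in [s] differ as
   [K > 0]. *)
move=> /coefXnM_eq[||_]; rewrite ?b0 ?coef0X ?a0 ?polyC_eq0 //.
  by rewrite expf_neq0 ?polyX_eq0.
move=> /(congr1 (fun p : {poly T} => size p)); rewrite size_polyXn size_polyC u_neq0.
by move=> /eqP; rewrite -[nat_of_bool true]/1%N eqSS gtn_eqF.
Qed.

End SkewAlgebra.

(** * Power subalgebras *)

Section LatticeCenter.
Variables (n : nat) (T : idomainType) (A : pzRingType).
Variables (C : {rmorphism T -> A}) (X : 'I_n -> A) (L : 'I_n -> nat).
Hypothesis C_comm : forall c x, x * C c = C c * x.
Hypothesis peval_inj : forall p, peval C X p = 0 -> p = 0.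
Hypothesis peval_surj : forall x, exists p, x = peval C X p.
Hypothesis L_gt0 : forall i, (0 < L i)%N.
Hypothesis XL_central : forall i, central (X i ^+ L i).
Local Notation pmon := (pmon X).
Local Notation peval := (peval C X).
Implicit Types (i j : 'I_n) (c : T) (m : 'X_{1..n}) (p q : mpoly n T) (x y z : A).

Definition mnm_scale m : 'X_{1..n} := [multinom (m i * L i)%N | i < n].

Lemma mnm_scale_inj : injective mnm_scale.
Proof.
move=> m m' mm'; apply/mnmP => i; apply/eqP; rewrite -(eqn_pmul2r (L_gt0 i)).
by have /mnmP/(_ i) := mm'; rewrite !mnmE => ->.
Qed.

(** An injective ring morphism onto the lattice-supported polynomials; followed by [peval] it
    parametrizes the centre by free variables. *)
Definition subst_powers : mpoly n T -> mpoly n T :=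
  mmap (mpolyC n (R := T)) (fun i => 'X_i ^+ L i).

Lemma subst_powersX m : subst_powers 'X_[m] = 'X_[mnm_scale m].
Proof.
rewrite /subst_powers mmapX [RHS]mpolyXE_id; apply: eq_bigr => i _.
by rewrite -exprM mnmE mulnC.
Qed.

Lemma subst_powersE p : subst_powers p = \sum_(m <- msupp p) p@_m *: 'X_[mnm_scale m].
Proof.
rewrite {1}[p]mpolyE /subst_powers raddf_sum; apply: eq_bigr => m _ /=.
by rewrite mmapZ -/(subst_powers _) subst_powersX mul_mpolyC.
Qed.

Lemma subst_powers_lattice p : lattice_supported L (subst_powers p).
Proof.
rewrite subst_powersE; elim/big_ind: _ => [|p1 p2|m _].
- by move=> m; rewrite msupp0.
- exact: lattice_supportedD.
- by move=> m' /msuppZ_le; rewrite msuppX inE => /eqP-> i; rewrite mnmE dvdn_mull.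
Qed.

Lemma subst_powers_inj : injective subst_powers.
Proof.
suff inj0 p : subst_powers p = 0 -> p = 0.
  move=> p q pq; apply/subr0_eq/inj0.
  by rewrite /subst_powers raddfB /= -/(subst_powers _) pq subrr.
move=> p0; apply/mpolyP => m; rewrite mcoeff0.
have := congr1 (mcoeff (mnm_scale m)) p0; rewrite subst_powersE mcoeff0 raddf_sum /=.
have [pm|/memN_msupp_eq0-> //] := boolP (m \in msupp p).
rewrite (bigD1_seq m) ?msupp_uniq //= mcoeffZ mcoeffX eqxx mulr1 big1 ?addr0 // => m' m'm.
by rewrite mcoeffZ mcoeffX (inj_eq mnm_scale_inj) (negbTE m'm) mulr0.
Qed.

Lemma subst_powers_surj p : lattice_supported L p -> exists p', subst_powers p' = p.
Proof.
move=> Lp; exists (\sum_(m <- msupp p) p@_m *: 'X_[[multinom (m i %/ L i)%N | i < n]]).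
rewrite {1}/subst_powers raddf_sum [RHS]mpolyE big_seq [RHS]big_seq.
apply: eq_bigr => m /Lp Lm /=; rewrite mmapZ -/(subst_powers _) subst_powersX mul_mpolyC.
by congr (_ *: 'X_[_]); apply/mnmP => i; rewrite !mnmE divnK.
Qed.

Lemma lattice_center_polynomial :
  (forall z, central z <-> exists2 p, lattice_supported L p & z = peval p) ->
  exists r (f : {rmorphism mpoly r T -> A}),
    [/\ injective f, forall c, f (mpolyC r c) = C c &
        forall z, central z <-> exists p : mpoly r T, f p = z].
Proof.
move=> centerP; pose f p := peval (subst_powers p).
have fB : zmod_morphism f by move=> p q; rewrite /f /subst_powers !raddfB.
have fM : monoid_morphism f.
  split=> [|p q]; first by rewrite /f /subst_powers rmorph1 -mpolyC1 pevalC rmorph1.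
  rewrite /f /subst_powers rmorphM peval_mul //; apply: lattice_supported_central => //.
  exact: subst_powers_lattice.
pose f' : {rmorphism mpoly n T -> A} := HB.pack f
  (GRing.isZmodMorphism.Build _ _ f fB) (GRing.isMonoidMorphism.Build _ _ f fM).
exists n, f'; split=> [|c|z].
- apply: raddf_inj => p /peval_inj p0; apply: subst_powers_inj.
  by rewrite p0 /subst_powers raddf0.
- by rewrite /= /f /subst_powers mmapC pevalC.
split=> [/centerP[p /subst_powers_surj[p' <-] ->]|[p <-]]; first by exists p'.
by apply/centerP; exists (subst_powers p) => //; apply: subst_powers_lattice.
Qed.

Local Notation powers := (fun x => (exists c, x = C c) \/ (exists i, x = X i ^+ L i)).

Let mnm_rem m : 'X_{1..n} := [multinom (m i %% L i)%N | i < n].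
Let mnm_quo m : 'X_{1..n} := [multinom (m i %/ L i * L i)%N | i < n].
(** [B] exceeds the degree of every exponent with all entries below [L i], so that these form a
    subset of a finite type. *)
Let B := (\sum_i L i).+1.
Let D := [pred t : 'X_{1..n < B} | [forall i, t i < L i]%N].

(** The basis consists of the monomials with all exponents below [L i]: division with remainder
    splits each exponent uniquely into a lattice part and such a remainder. *)
Lemma lattice_finite_free : exists r (b : 'I_r -> A),
    (forall v, exists2 c : 'I_r -> A,
        forall k, subring_gen powers (c k) & v = \sum_k c k * b k) /\
    (forall c : 'I_r -> A, (forall k, subring_gen powers (c k)) ->
        \sum_k c k * b k = 0 -> forall k, c k = 0).
Proof.
pose bm (k : 'I_#|D|) : 'X_{1..n} := enum_val k.
have bm_lt k i : (bm k i < L i)%N by have /forallP := enum_valP k; apply.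
exists #|D|, (fun k => pmon (bm k)); split=> [v|c Gc].
  suff [s Ls ->] : exists2 s : 'I_#|D| -> mpoly n T,
      forall k, lattice_supported L (s k) & v = \sum_k peval (s k) * pmon (bm k).
    exists (fun k => peval (s k)) => // k; apply/subring_gen_powersE => //.
    by exists (s k).
  have [p ->] := peval_surj v.
  rewrite [peval p](_ : _ = \sum_(m <- msupp p) C p@_m * pmon m) //.
  elim/big_ind: _ => [|_ _ [s Ls ->] [s' Ls' ->]|m _].
  - exists (fun=> 0) => [k m|]; first by rewrite msupp0.
    by rewrite big1 // => k _; rewrite raddf0 mul0r.
  - exists (fun k => s k + s' k) => [k|]; first exact: lattice_supportedD.
    by rewrite -big_split; apply: eq_bigr => k _; rewrite raddfD mulrDl.
  have rem_lt : (mdeg (mnm_rem m) < B)%N.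
    by rewrite ltnS mdegE; apply: leq_sum => i _; rewrite mnmE ltnW ?ltn_mod.
  have Dm : BMultinom rem_lt \in D.
    by rewrite inE; apply/forallP => i; rewrite mnmE ltn_mod.
  pose k0 := enum_rank_in Dm (BMultinom rem_lt).
  have k0E : bm k0 = mnm_rem m by rewrite /bm enum_rankK_in.
  pose s k : mpoly n T := if k == k0 then p@_m *: 'X_[mnm_quo m] else 0.
  have Lquo i : (L i %| mnm_quo m i)%N by rewrite mnmE dvdn_mull.
  exists s => [k|].
    rewrite /s; case: eqP => _ m'; last by rewrite msupp0.
    by move=> /msuppZ_le; rewrite msuppX inE => /eqP->.
  rewrite (bigD1 k0) //= big1 ?addr0 => [|k /negbTE kk0]; last first.
    by rewrite /s kk0 raddf0 mul0r.
  rewrite /s eqxx k0E pevalZ pevalX -mulrA; congr (_ * _).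
  rewrite -[LHS](_ : pmon (mnm_quo m + mnm_rem m)%MM = _); last first.
    by congr pmon; apply/mnmP => i; rewrite mnmDE !mnmE -divn_eq.
  exact: (pmonD _ (lattice_exp_central XL_central Lquo)).2.
have /choice[s sP] k : exists s, lattice_supported L s /\ c k = peval s.
  by have /(subring_gen_powersE C_comm XL_central)[s Ls ->] := Gc k; exists s.
move=> c0 k; have Ls k' := (sP k').1.
have {c0} : \sum_k' s k' * 'X_[bm k'] = 0.
  apply: peval_inj; rewrite raddf_sum -[RHS]c0; apply: eq_bigr => k' _ /=.
  rewrite peval_mul ?pevalX ?(sP k').2 //.
  exact: (lattice_supported_central XL_central).
move=> s0; rewrite (sP k).2; suff -> : s k = 0 by rewrite raddf0.
apply/mpolyP => m; rewrite mcoeff0; apply/eqP; apply: contraT => skm.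
have {}skm : m \in msupp (s k) by rewrite mcoeff_msupp.
(* Only the summand [k] reaches this exponent, because residues modulo the [L i] determine the basis
   monomial. *)
have := congr1 (mcoeff (m + bm k)%MM) s0; rewrite mcoeff0 raddf_sum /= (bigD1 k) //=.
rewrite [(m + bm k)%MM]addmC mcoeffMX big1 ?addr0 => [/eqP|k' k'k].
  by rewrite mcoeff_eq0 skm.
apply: memN_msupp_eq0; rewrite (perm_mem (msuppMX _ _)); apply/negP => /mapP[m' sm' mE].
case/eqP: k'k; apply/enum_val_inj/val_inj; rewrite -/(bm k') -/(bm k).
apply/mnmP => i; have /mnmP/(_ i) := mE; rewrite !mnmDE => mEi.
have small (x y : nat) : (x < L i)%N -> (L i %| y)%N -> ((x + y) %% L i)%N = x.
  by move=> xL /dvdnP[u ->]; rewrite addnC modnMDl modn_small.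
rewrite -(small (bm k' i) (m' i)) ?bm_lt ?(Ls k' m' sm') //.
by rewrite -mEi small // (Ls k m skm).
Qed.

End LatticeCenter.

(** The constants left behind as [y] crosses one [x] after another add up to [d] times the
    [c]-integer of [e.+1]. *)
Lemma quantum_exp_swap (T : comRingType) (A : pzRingType) (C : {rmorphism T -> A})
    (x y : A) (c d : T) :
  (forall c x, x * C c = C c * x) -> y * x = C c * (x * y) + C d ->
  forall e, y * x ^+ e.+1 = C (c ^+ e.+1) * (x ^+ e.+1 * y)
    + C (d * \sum_(i < e.+1) c ^+ i) * x ^+ e.
Proof.
move=> C_comm yx; elim=> [|e IHe].
  by rewrite !expr1 big_ord1 expr0 !mulr1 yx.
have CA c' z w : z * (C c' * w) = C c' * (z * w) by rewrite mulrA C_comm mulrA.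
rewrite [x ^+ e.+2]exprSr mulrA IHe mulrDl -!mulrA yx mulrDr -exprSr.
rewrite CA C_comm mulrDr [C _ * (C c * _)]mulrA [C _ * (C d * _)]mulrA -!(rmorphM C).
rewrite -exprSr -addrA -mulrDl -rmorphD; congr (_ + C _ * _).
by rewrite [in RHS]big_ord_recr /= mulrDr addrC [d * c ^+ _]mulrC.
Qed.

Lemma root_of_unity_sum (T : idomainType) (c : T) e : c ^+ e = 1 -> c != 1 ->
  \sum_(i < e) c ^+ i = 0.
Proof.
move=> ce c1; apply/eqP; have := subrX1 c e; rewrite ce subrr => /esym/eqP.
by rewrite mulf_eq0 subr_eq0 (negbTE c1).
Qed.

Lemma quantum_power_comm n (T : idomainType) (q b : 'I_n -> 'I_n -> T)
    (A : pzRingType) (C : {rmorphism T -> A}) (X : 'I_n -> A) (i j : 'I_n) e :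
  (forall i j : 'I_n, (i < j)%N -> q i j \is a GRing.unit) ->
  (forall c x, x * C c = C c * x) -> quantum_rel q C X b ->
  (0 < e)%N -> qfull q i j ^+ e = 1 -> (i != j -> qfull q i j != 1) ->
  X i ^+ e * X j = X j * X i ^+ e.
Proof.
move=> q_unit C_comm rel e0 Qe Q1.
have [<-|ij] := eqVneq i j; first by rewrite -exprSr exprS.
have [c jiE] := quantum_swap q_unit rel i j.
have := quantum_exp_swap C_comm jiE e.-1; rewrite prednK // Qe.
rewrite (root_of_unity_sum Qe (Q1 ij)) mulr0 rmorph0 rmorph1 mul0r addr0 mul1r.
by move=> ->.
Qed.

(** * Centres of algebras presented by quantum relations *)

Section PresentedCenter.
Variables (n : nat) (T : idomainType) (q b : 'I_n -> 'I_n -> T).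
Variable S : free_alg n T -> Prop.
Hypothesis q_unit : forall i j : 'I_n, (i < j)%N -> q i j \is a GRing.unit.
Hypothesis rel : quantum_rel q (pcst S) (pvar S) b.
Local Notation peval := (peval (pcst S) (pvar S)).

Lemma presented_peval_surj x : exists p, x = peval p.
Proof.
apply: (@peval_surj n T _ (deg_filtration S) (pcst S) (pvar S) (qfull q)).
- by move=> c y; apply: pcstC.
- exact: deg_fil_cst.
- exact: deg_fil_var.
- by move=> k y; apply: deg_fil_words.
- exact: deg_fil_all.
- by move=> i j; apply: qfull_unit.
- exact: (fil_swap q_unit rel (F := deg_filtration S) (@deg_fil_cst _ _ S)).
Qed.

Hypothesis peval_inj : forall p, peval p = 0 -> p = 0.
Hypothesis qcentral_central :
  forall m, qcentral (qfull q) m -> central (pmon (pvar S) m).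

Lemma presented_centerP z : central z <->
  exists2 p, (forall m, m \in msupp p -> qcentral (qfull q) m) & z = peval p.
Proof.
apply: (@filtered_centerP n T _ (deg_filtration S) (pcst S) (pvar S) (qfull q)).
- by move=> c y; apply: pcstC.
- exact: deg_fil_cst.
- exact: deg_fil_var.
- by move=> k y; apply: deg_fil_words.
- exact: deg_fil_all.
- by move=> i j; apply: qfull_unit.
- exact: (fil_swap q_unit rel (F := deg_filtration S) (@deg_fil_cst _ _ S)).
- exact: peval_inj.
- exact: qcentral_central.
Qed.

(** By linear independence a central monomial lies in the power subalgebra only if its exponent is
    in the lattice, so both subrings are compared exponent by exponent. *)
Lemma presented_center_power_subalg L :
  (forall i, central (pvar S i ^+ L i)) ->
  (forall m, qlattice L m -> qcentral (qfull q) m) ->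
  center_is (power_subalg (S := S) L) <->
  (forall m, qcentral (qfull q) m -> qlattice L m).
Proof.
move=> XL LM; have powersE := subring_gen_powersE (@pcstC _ _ S) XL.
split=> [cS m Mm|ML z].
  have /cS/powersE[p Lp pE] := qcentral_central Mm.
  have pX : p = 'X_[m].
    by apply/subr0_eq/peval_inj; rewrite raddfB /= pevalX pE subrr.
  by apply/forallP; apply: Lp; rewrite pX msuppX inE.
split=> [/presented_centerP[p Mp ->]|/powersE[p Lp ->]]; last first.
  apply/presented_centerP; exists p => // m pm; apply/LM/forallP.
  exact: Lp.
by apply/powersE; exists p => // m /Mp/ML/forallP.
Qed.

End PresentedCenter.

Theorem theorem0p3 (R : realType) (T : idomainType) (n : nat)
    (q a : 'I_n -> 'I_n -> T)
    (q_unit : forall i j : 'I_n, (i < j)%N -> q i j \is a GRing.unit)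
    (q_root : forall i j : 'I_n, (i < j)%N ->
       exists2 m : nat, (0 < m)%N & q i j ^+ m = 1)
    (q_neq1 : forall i j : 'I_n, (i < j)%N -> q i j <> 1)
    (d : 'I_n -> 'I_n -> nat)
    (d_order : forall i j, (d i j).-primitive_root (qfull q i j))
    (phi : T -> R[i]) (phi_id : complex_identification q phi)
    (k : 'I_n -> 'I_n -> int) (k_exp : exponents_of q phi d k) :
  [<-> center_is_polynomial_ring (skew_relator q);
       center_is (power_subalg (S := skew_relator q) (Lexp d));
       forall p m : nat, prime p -> (0 < m)%N -> Ipm d p m != set0 ->
         \det (Ybar_pm d k p m) != 0]
  /\
  (gr_naturally_skew q a ->
   center_is (power_subalg (S := skew_relator q) (Lexp d)) ->
   center_is (power_subalg (S := weyl_relator q a) (Lexp d)) /\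
   finite_free_over (power_subalg (S := weyl_relator q a) (Lexp d))).
Proof.
set Q := qfull q; set L := Lexp d.
have d_gt0 i j : (0 < d i j)%N by apply: prim_order_gt0 (d_order i j).
have Qd i j e : (Q i j ^+ e == 1) = (d i j %| e)%N.
  by rewrite -(prim_order_dvd (d_order i j)).
have d_sym i j : d i j = d j i.
  apply/eqP; rewrite eqn_dvd -!Qd /Q (qfullV q i j) exprVn invr_eq1 Qd dvdnn.
  by rewrite -invr_eq1 -exprVn -qfullV Qd dvdnn.
have k_skew i j : k i j = - k j i by have [] := k_exp i j.
have L_gt0 i : (0 < L i)%N.
  by rewrite /L /Lexp; elim/big_ind: _ => // x y x0 y0; rewrite lcmn_gt0 x0.
have dL i j : (d i j %| L i)%N by apply: d_dvd_Lexp.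
(* Any common multiple of the [L i] serves as the common denominator of the exponents. *)
pose D := (\prod_i L i)%N; have D_gt0 : (0 < D)%N by rewrite prodn_gt0.
have LD i : (L i %| D)%N by rewrite /D (bigD1 i) //= dvdn_mulr.
have qcentralE m : qcentral Q m <-> exp_central d k D m.
  have dD i j := dvdn_trans (dL i j) (LD i).
  have E i := qfull_prod_eq1 i m phi_id k_exp D_gt0 dD.
  by split=> [/forallP M i|M]; [rewrite -E; apply: M | apply/forallP => i; rewrite E].
(* The inclusion of the monoid in the lattice is the pivot: the determinants express it here, and
   [S_power] identifies it with the second condition. *)
have MLP : (forall m, qcentral Q m -> qlattice L m) <->
    (forall p m : nat, prime p -> (0 < m)%N -> Ipm d p m != set0 ->
       \det (Ybar_pm d k p m) != 0).
  rewrite -(exp_central_latticeP d_gt0 d_sym k_skew D_gt0 LD).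
  split=> [ML al Mal i|ML m /qcentralE/ML Lm]; last exact/forallP.
  have /ML/forallP/(_ i) : qcentral Q [multinom al i | i < n].
    apply/qcentralE => j.
    rewrite (eq_bigr (fun l => k j l * (D %/ d j l)%N * (al l)%:Z)) // => l _.
    by rewrite mnmE.
  by rewrite mnmE.
have LM m : qlattice L m -> qcentral Q m.
  move=> /forallP Lm; apply/forallP => i; apply/eqP/big1 => j _; apply/eqP.
  by rewrite Qd d_sym (dvdn_trans (dL j i)).
have qcentralU i e : qcentral Q (U_(i) *+ e)%MM = (L i %| e)%N.
  have E j : \prod_l Q j l ^+ (U_(i) *+ e)%MM l = Q j i ^+ e.
    rewrite (bigD1 i) //= mulmnE mnm1E eqxx mul1n big1 ?mulr1 // => l li.
    by rewrite mulmnE mnm1E eq_sym (negbTE li).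
  apply/forallP/dvdn_biglcmP => [M j _|M j]; first by have := M j; rewrite E Qd d_sym.
  by rewrite E Qd d_sym; apply: M.
have Q_unit := qfull_unit q_unit.
have S_inj := skew_peval_inj q_unit.
have S_surj := presented_peval_surj q_unit (skew_quantum_rel q).
have S_swap := skew_swap q_unit (skew_quantum_rel q).
have S_central := skew_pmon_central (@pcstC _ _ (skew_relator q)) S_swap S_surj.
have S_center := presented_centerP q_unit (skew_quantum_rel q) S_inj S_central.
have S_XL i : central (pvar (skew_relator q) i ^+ L i).
  by rewrite -pmonU; apply: S_central; rewrite qcentralU.
have S_power := presented_center_power_subalg q_unit (skew_quantum_rel q)
  S_inj S_central S_XL LM.
split.
  tfae.
  - case=> r [f [f_inj fC f_center]]; apply/S_power.
    exact: (polynomial_center_lattice (@pcstC _ _ _) Q_unit S_swap S_inj S_surj S_center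
      L_gt0 qcentralU f_inj fC f_center).
  - by move=> /S_power/MLP.
  - move=> /MLP ML.
    apply: (lattice_center_polynomial (@pcstC _ _ _) S_inj L_gt0 S_XL) => z.
    split=> [/S_center[p Mp ->]|[p Lp ->]].
      by exists p => // m /Mp/ML/forallP.
    by apply/S_center; exists p => // m pm; apply/LM/forallP/Lp.
move=> gr_nat /S_power ML.
have V_rel := weyl_quantum_rel q a.
have V_inj := weyl_peval_inj q_unit gr_nat.
have V_surj := presented_peval_surj q_unit V_rel.
have V_XL i : central (pvar (weyl_relator q a) i ^+ L i).
  apply: (central_of_vars (@pcstC _ _ _) V_surj) => j.
  apply: (quantum_power_comm q_unit (@pcstC _ _ _) V_rel (L_gt0 i)) => [|ij].
    by apply/eqP; rewrite Qd.
  rewrite /qfull; case: ltngtP ij => [ij _|ji _|/val_inj->]; last by rewrite eqxx.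
    exact/eqP/q_neq1.
  by rewrite invr_eq1; apply/eqP/q_neq1.
(* With constant terms in the relations, [qcentral] alone gives commutation only up to lower degree;
   by [ML] the monomial is a product of central powers. *)
have V_central m : qcentral Q m -> central (pmon (pvar (weyl_relator q a)) m).
  by move=> /ML/forallP; apply: lattice_pmon_central V_XL _.
split; first exact/(presented_center_power_subalg q_unit V_rel V_inj V_central V_XL LM).
exact: (lattice_finite_free (@pcstC _ _ _) V_inj V_surj L_gt0 V_XL).
Qed.
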